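(* Suppose that $\mathrm{Re}(\lambda_l(A))\neq\rho$ for $l=1,\dots,n$, that $(A,B)$ is stabilizable, and that $A-0.5\rho\,\mathbb{I}_n$ is Hurwitz. Suppose further that there exists a positive integer $\hat d$ such that $$\mathrm{rank}\big([\widehat{\mathcal{I}}_{\mathcal{X}},\ \mathcal{I}_{\mathcal{X}\mathcal{V}}]\big)=mn+\frac{n(n+1)}{2}$$ holds for every $d\ge\hat d$, where $\widehat{\mathcal{I}}_{\mathcal{X}},\mathcal{I}_{\mathcal{X}\mathcal{V}}$ are the data matrices built from $d$ sampling intervals (see context). Then, for $d\ge\hat d$, the sequence $\{\mathcal{K}^k\}_{k=0}^{+\infty}$ generated by the data-driven value iteration algorithm described in the context satisfies $$\lim_{k\to+\infty}\mathcal{K}^k=K^* .$$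
   Context: **Setting.** $A\in\mathbb{R}^{n\times n}$, $B\in\mathbb{R}^{n\times m}$, $C\in\mathbb{R}^{n\times p}$ are constant matrices; $Q\in\mathbb{R}^{n\times n}$ and $R\in\mathbb{R}^{m\times m}$ are symmetric positive definite; $\rho>0$ is a discount parameter. $\lambda_l(M)$ is the $l$-th eigenvalue of a square matrix $M$. A matrix is Hurwitz if all its eigenvalues have negative real part. $\mathbb{S}^n_+$ is the set of symmetric positive semidefinite $n\times n$ real matrices. $M^\dagger$ is the Moore–Penrose pseudoinverse, $\otimes$ the Kronecker product, $\mathbb{I}_n$ the $n\times n$ identity. **Target gain.** $P^*>0$ is the positive definite solution of $\rho P=PA+A^TP-PBR^{-1}B^TP+Q$, and $K^*=R^{-1}B^TP^*$. **Data.** Fix an agent $i$ with state $dx_i(t)=[Ax_i(t)+Bu_i(t)]dt+C\,dW_i(t)$, $x_i(0)=x_{i0}$, where $W_i$ is a standard $p$-dimensional Brownian motion, $x_{i0}$ is independent of $W_i$ with finite second moment, and $u_i$ is an admissible control, i.e. an $\mathbb{R}^m$-valued process adapted to the filtration generated by $W_i$ with $\mathbb{E}\int_0^{+\infty}e^{-\rho t}|u_i(t)|^2dt<+\infty$. Put $\mathcal{X}(t)=\mathbb{E}[x_i(t)]$, $\mathcal{V}(t)=\mathbb{E}[u_i(t)]$, so that $d\mathcal{X}(t)=[A\mathcal{X}(t)+B\mathcal{V}(t)]dt$, $\mathcal{X}(0)=\mathbb{E}[x_{i0}]$. **Vectorizations.** For a matrix $M$, $vec(M)$ stacks its columns. For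 symmetric $S\in\mathbb{R}^{n\times n}$, $vecs(S)=[S_{11},2S_{12},\dots,2S_{1n},S_{22},2S_{23},\dots,2S_{n-1,n},S_{nn}]^T$. For $\zeta\in\mathbb{R}^n$, $\overline{\zeta}=[\zeta_1^2,\zeta_1\zeta_2,\dots,\zeta_1\zeta_n,\zeta_2^2,\zeta_2\zeta_3,\dots,\zeta_{n-1}\zeta_n,\zeta_n^2]^T$, and $\overline{\mathcal{X}}(t)$ denotes $\overline{\zeta}$ for $\zeta=\mathcal{X}(t)$. **Data matrices.** For sampling times $0\le s_0<s_1<s_2<\cdots$ and a positive integer $d$ (the matrices below use $s_0,\dots,s_d$), define - $\mathcal{I}\in\mathbb{R}^{d\times n(n+1)/2}$, whose $(j+1)$-th row is $e^{-\rho s_{j+1}}\overline{\mathcal{X}}(s_{j+1})^T-e^{-\rho s_j}\overline{\mathcal{X}}(s_j)^T$; - $\widehat{\mathcal{I}}_{\mathcal{X}}\in\mathbb{R}^{d\times n(n+1)/2}$, whose $(j+1)$-th row is $\int_{s_j}^{s_{j+1}}e^{-\rho t}\overline{\mathcal{X}}(t)^Tdt$; - $\mathcal{I}_{\mathcal{X}\mathcal{V}}\in\mathbb{R}^{d\times nm}$, whose $(j+1)$-th row is $\int_{s_j}^{s_{j+1}}e^{-\rho t}[\mathcal{X}(t)\otimes\mathcal{V}(t)]^Tdt$, for $j=0,\dots,d-1$. **Data-driven value iteration algorithm.** Choose a positive definite symmetric $\mathcal{P}^0\in\mathbb{R}^{n\times n}$, step sizes $\gamma_k>0$ ($k=0,1,2,\dots$)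 with $\sum_{k=0}^{+\infty}\gamma_k=+\infty$ and $\sum_{k=0}^{+\infty}\gamma_k^2<+\infty$, and bounded sets $\{\mathcal{D}_q\}_{q=0}^{+\infty}$ with $\mathcal{D}_q\subseteq\mathcal{D}_{q+1}$ for all $q\geq 0$ and $\lim_{q\to+\infty}\mathcal{D}_q=\mathbb{S}^n_+$. Start with $k=0$, $q=0$. For $k=0,1,2,\dots$: 1. Define symmetric $\mathcal{M}^k\in\mathbb{R}^{n\times n}$ and $\mathcal{N}^k\in\mathbb{R}^{m\times n}$ by $\begin{bmatrix}vecs(\mathcal{M}^k)\\ vec(\mathcal{N}^k)\end{bmatrix}=\big[\widehat{\mathcal{I}}_{\mathcal{X}},\ 2\mathcal{I}_{\mathcal{X}\mathcal{V}}\big]^\dagger\,\mathcal{I}\,vecs(\mathcal{P}^k)$. 2. Set $\mathcal{K}^k=R^{-1}\mathcal{N}^k$ and $\widetilde{\mathcal{P}}=\mathcal{P}^k+\gamma_k\big(\mathcal{M}^k-(\mathcal{K}^k)^TR\mathcal{K}^k+Q\big)$. 3. If $\widetilde{\mathcal{P}}\notin\mathcal{D}_q$, set $\mathcal{P}^{k+1}=\mathcal{P}^0$ and increase $q$ by $1$; otherwise set $\mathcal{P}^{k+1}=\widetilde{\mathcal{P}}$ (with $q$ unchanged). The iteration is considered without the numerical stopping test, so that an infinite sequence is generated.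
   Formalization: The limit of the sets D_q is read as: their union is the cone of positive semidefinite matrices and, in addition, every bounded subset of that cone lies in some D_q; with the union alone the algorithm can reset to P^0 at every step and the claim fails. *)

(* Defs.v *)
From HB Require Import structures.
From mathcomp Require Import all_boot all_order all_algebra.
From mathcomp Require Import all_classical all_reals all_analysis.
From mathcomp Require Import complex mxtens zify.

Set Implicit Arguments.
Unset Strict Implicit.
Unset Printing Implicit Defensive.

Import Order.TTheory GRing.Theory Num.Theory.
Import numFieldNormedType.Exports.

Local Open Scope classical_set_scope.
Local Open Scope ring_scope.

Section MatrixNotions.
Context {R : realType}.

Definition spectrum n (A : 'M[R]_n) : set R[i] :=
  [set z | eigenvalue (map_mx (real_complex R) A) z].

Definition hurwitz n (A : 'M[R]_n) : Prop :=
  forall z, spectrum A z -> complex.Re z < 0.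

Definition stabilizable n m (A : 'M[R]_n) (B : 'M[R]_(n, m)) : Prop :=
  exists K : 'M[R]_(m, n), hurwitz (A - B *m K).

Definition posdef n (S : 'M[R]_n) : Prop :=
  S^T = S /\ forall x : 'cV[R]_n, x != 0 -> 0 < (x^T *m S *m x) 0 0.

Definition possemidef n (S : 'M[R]_n) : Prop :=
  S^T = S /\ forall x : 'cV[R]_n, 0 <= (x^T *m S *m x) 0 0.

Definition is_pinv a b (M : 'M[R]_(a, b)) (Y : 'M[R]_(b, a)) : Prop :=
  [/\ M *m Y *m M = M, Y *m M *m Y = Y,
      (M *m Y)^T = M *m Y & (Y *m M)^T = Y *m M].

(* [is_pinv M] holds of exactly one matrix (Penrose), so the default value 0
   is never used. *)
Definition pinv a b (M : 'M[R]_(a, b)) : 'M[R]_(b, a) :=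
  xget 0 [set Y | is_pinv M Y].

(* [mxvec] is row-major, hence the transpose. *)
Definition vec a b (M : 'M[R]_(a, b)) : 'cV[R]_(b * a) := (mxvec M^T)^T.

(* (1,1), (1,2), ..., (1,n), (2,2), (2,3), ..., (n-1,n), (n,n) *)
Definition upper_pairs n : seq ('I_n * 'I_n) :=
  [seq (i, j) | i : 'I_n <- enum 'I_n,
                j : 'I_n <- [seq k : 'I_n <- enum 'I_n | (i <= k)%N]].


Lemma upper_row n (i : 'I_n) :
  [seq val k | k : 'I_n <- [seq k : 'I_n <- enum 'I_n | (i <= k)%N]]
    = iota i (n - i).
Proof.
transitivity [seq k <- iota 0 n | (i <= k)%N]; first by rewrite -val_enum_ord filter_map.
have := ltnW (ltn_ord i); move: (val i) => {}i lein.
rewrite -{1}(subnKC lein) iotaD filter_cat add0n.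
rewrite (eq_in_filter (a2 := pred0)) ?filter_pred0; last by move=> k; rewrite mem_iota /=; lia.
by rewrite (eq_in_filter (a2 := predT)) ?filter_predT //= => k; rewrite mem_iota /=; lia.
Qed.

Lemma size_upper_pairs n : size (upper_pairs n) = (n * n.+1)./2.
Proof.
rewrite /upper_pairs size_allpairs_dep sumnE big_map big_enum /=.
rewrite (eq_bigr (fun i : 'I_n => (n - i)%N)) => [|i _]; last first.
  by rewrite -(size_map val) upper_row size_iota.
rewrite (reindex_inj rev_ord_inj) /=.
rewrite (eq_bigr (fun i : 'I_n => (i.+1)%N)) => [|i _]; last by have := ltn_ord i; lia.
rewrite -(big_mkord xpredT (fun i => i.+1)).
elim: n => [|n IH]; first by rewrite big_nil.
rewrite big_nat_recr //= IH. nia.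
Qed.

(* The column whose entries are the list [s]; it is only used on lists with
   exactly [N] elements, see [size_upper_pairs]. *)
Definition col_of_seq N (s : seq R) : 'cV[R]_N := \col_(k < N) s`_k.

Definition vecs n (S : 'M[R]_n) : 'cV[R]_((n * n.+1)./2) :=
  col_of_seq _ [seq (if ij.1 == ij.2 then 1 else 2) * S ij.1 ij.2
               | ij <- upper_pairs n].

Definition quadv n (x : 'cV[R]_n) : 'cV[R]_((n * n.+1)./2) :=
  col_of_seq _ [seq x ij.1 0 * x ij.2 0 | ij <- upper_pairs n].

(* The Kronecker product has n * m rows and 1 * 1 columns. *)
Definition kronv n m (x : 'cV[R]_n) (v : 'cV[R]_m) : 'cV[R]_(n * m) :=
  tensmx x v.

Definition mxint a b (D : set R) (F : R -> 'M[R]_(a, b)) : 'M[R]_(a, b) :=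
  \matrix_(i, j) \int[lebesgue_measure]_(t in D) F t i j.

Definition sqnorm n (x : 'cV[R]_n) : R := \sum_i x i 0 ^+ 2.

End MatrixNotions.

Definition times {R : realType} : set R := `[0, +oo[.

Section Stochastic.
Context {R : realType} {d : measure_display} {T : measurableType d}.
Variable P : probability T R.

Definition expect n (X : T -> 'cV[R]_n) : 'cV[R]_n :=
  \col_i fine 'E_P[fun w => X w i 0].

Definition random_vector n (X : T -> 'cV[R]_n) : Prop :=
  forall i, measurable_fun [set: T] (fun w => X w i 0).

Definition measurable_process n (X : R -> T -> 'cV[R]_n) : Prop :=
  forall i, measurable_fun
    (times `*` [set: T] : set (measurableTypeR R * T))
    (fun z => X z.1 z.2 i 0).

Definition sigma_gen (I : Type) (J : set I) (X : I -> T -> R) : set (set T) :=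
  <<s \bigcup_(i in J) preimage_set_system [set: T] (X i) measurable >>.

Definition mutually_independent (I : finType) (X : I -> T -> R) : Prop :=
  forall E : I -> set R, (forall i, measurable (E i)) ->
    P [set w | forall i, E i (X i w)]
      = (\big[*%E/1]_i P (X i @^-1` E i))%E.

Definition coord n (W : R -> T -> 'cV[R]_n) (sl : R * 'I_n) (w : T) : R :=
  W sl.1 w sl.2 0.

Definition natural_filtration n (W : R -> T -> 'cV[R]_n) (t : R)
    : set (set T) :=
  sigma_gen [set sl | 0 <= sl.1 <= t] (coord W).

(* Independence of the increments over consecutive time intervals and,
   simultaneously, of the p coordinates of each of them. *)
Record brownian_motion p (W : R -> T -> 'cV[R]_p) : Prop := {
  bm_meas : measurable_process W ;
  bm_start : {ae P, forall w, W 0 w = 0} ;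
  bm_cont : {ae P, forall w, {within times, continuous (W ^~ w)}} ;
  bm_indep : forall (N : nat) (t : nat -> R), 0 <= t 0%N ->
    (forall k, t k < t k.+1) ->
    mutually_independent (fun (kl : 'I_N * 'I_p) w =>
      (W (t kl.1.+1) w - W (t kl.1) w) kl.2 0) ;
  bm_gauss : forall (s t : R) (l : 'I_p), 0 <= s -> s < t ->
    forall E : set R, measurable E ->
    P ((fun w => (W t w - W s w) l 0) @^-1` E)
      = normal_prob 0 (Num.sqrt (t - s)) E }.

Record initial_state n p (W : R -> T -> 'cV[R]_p) (x0 : T -> 'cV[R]_n)
    : Prop := {
  init_meas : random_vector x0 ;
  init_moment2 : ('E_P[fun w => sqnorm (x0 w)] < +oo)%E ;
  init_indep : forall E F,
    sigma_gen [set: 'I_n] (fun i w => x0 w i 0) E ->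
    sigma_gen [set sl | 0 <= sl.1] (coord W) F ->
    P (E `&` F) = (P E * P F)%E }.

Record admissible m p (rho : R) (W : R -> T -> 'cV[R]_p)
    (u : R -> T -> 'cV[R]_m) : Prop := {
  adm_meas : measurable_process u ;
  adm_adapted : forall (t : R) (i : 'I_m) (E : set R), 0 <= t ->
    measurable E -> natural_filtration W t ((fun w => u t w i 0) @^-1` E) ;
  adm_moment2 : (\int[P]_w \int[lebesgue_measure]_(t in times)
    (expR (- rho * t) * sqnorm (u t w))%:E < +oo)%E }.

(* The noise being additive with a constant coefficient, the stochastic
   integral of C is C W(t), and the equation
   dx = (A x + B u) dt + C dW, x(0) = x0, is a pathwise integral equation. *)
Record solves_sde n m p (A : 'M[R]_n) (B : 'M[R]_(n, m)) (C : 'M[R]_(n, p))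
    (W : R -> T -> 'cV[R]_p) (x0 : T -> 'cV[R]_n)
    (u : R -> T -> 'cV[R]_m) (x : R -> T -> 'cV[R]_n) : Prop := {
  sde_meas : measurable_process x ;
  sde_cont : {ae P, forall w, {within times, continuous (x ^~ w)}} ;
  sde_eq : {ae P, forall w, forall t : R, 0 <= t ->
    x t w = x0 w + mxint `[0, t] (fun s => A *m x s w + B *m u s w)
            + C *m W t w} }.

End Stochastic.

Section DataMatrices.
Context {R : realType} {n m : nat}.
Variables (rho : R) (s : nat -> R) (X : R -> 'cV[R]_n) (V : R -> 'cV[R]_m).

Definition data_I (d : nat) : 'M[R]_(d, (n * n.+1)./2) :=
  \matrix_(j < d) (expR (- rho * s j.+1) *: (quadv (X (s j.+1)))^T
                   - expR (- rho * s j) *: (quadv (X (s j)))^T).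

Definition data_IX (d : nat) : 'M[R]_(d, (n * n.+1)./2) :=
  \matrix_(j < d) mxint `[s j, s j.+1]
    (fun t => expR (- rho * t) *: (quadv (X t))^T).

Definition data_IXV (d : nat) : 'M[R]_(d, n * m) :=
  \matrix_(j < d) mxint `[s j, s j.+1]
    (fun t => expR (- rho * t) *: (kronv (X t) (V t))^T).

End DataMatrices.

Section Algorithm.
Context {R : realType} {n m : nat}.

Record step_sizes (gamma : nat -> R) : Prop := {
  step_gt0 : forall k, 0 < gamma k ;
  step_sum : (\sum_(0 <= k <oo) (gamma k)%:E = +oo)%E ;
  step_sum2 : (\sum_(0 <= k <oo) (gamma k ^+ 2)%:E < +oo)%E }.

(* D_q increases to the cone of positive semidefinite matrices: the union of
   the D_q is the cone, and it is attained uniformly on bounded parts, i.e.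
   each bounded part of the cone lies in some D_q.  The second requirement is
   not implied by the first, and convergence fails without it: with
   D_q := (cone `&` ball of radius q) minus the points
   P0 + gamma_k (A^T P0 + P0 A - rho P0 - P0 B Rw^-1 B^T P0 + Qw), k >= q,
   the algorithm may be reset to P0 at every step. *)
Record truncations (D : nat -> set 'M[R]_n) : Prop := {
  trunc_bounded : forall q, bounded_set (D q) ;
  trunc_nested : forall q, D q `<=` D q.+1 ;
  trunc_lim : \bigcup_q D q = [set S | possemidef S] ;
  trunc_lim_unif : forall E : set 'M[R]_n, bounded_set E ->
    E `<=` [set S | possemidef S] -> exists q, E `<=` D q }.

Definition candidate (Qw : 'M[R]_n) (Rw : 'M[R]_m) (g : R)
    (P M : 'M[R]_n) (K : 'M[R]_(m, n)) : 'M[R]_n :=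
  P + g *: (M - K^T *m Rw *m K + Qw).

(* P k, M k, N k, K k are the iterates and q k is the value of the counter q
   at the beginning of the k-th pass. *)
Record value_iteration d (IX I : 'M[R]_(d, (n * n.+1)./2))
    (IXV : 'M[R]_(d, n * m)) (Qw : 'M[R]_n) (Rw : 'M[R]_m)
    (P0 : 'M[R]_n) (gamma : nat -> R) (D : nat -> set 'M[R]_n)
    (P M : nat -> 'M[R]_n) (N K : nat -> 'M[R]_(m, n)) (q : nat -> nat)
    : Prop := {
  vi_P0 : P 0%N = P0 ;
  vi_q0 : q 0%N = 0%N ;
  vi_symM : forall k, (M k)^T = M k ;
  vi_MN : forall k, col_mx (vecs (M k)) (vec (N k))
    = pinv (row_mx IX (2 *: IXV)) *m I *m vecs (P k) ;
  vi_K : forall k, K k = invmx Rw *m N k ;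
  vi_reset : forall k, ~ D (q k) (candidate Qw Rw (gamma k) (P k) (M k) (K k)) ->
    P k.+1 = P0 /\ q k.+1 = (q k).+1 ;
  vi_keep : forall k, D (q k) (candidate Qw Rw (gamma k) (P k) (M k) (K k)) ->
    P k.+1 = candidate Qw Rw (gamma k) (P k) (M k) (K k) /\ q k.+1 = q k }.

End Algorithm.

(* Main.v *)
(* Let A' = A - (rho / 2) I and G = B R^-1 B^T.  The product rule for absolutely
   continuous functions, applied to the mean X, which solves X' = A X + B V,
   shows that (P A + A^T P - rho P, B^T P) solves the linear system for (M, N);
   by the rank condition the pseudoinverse returns exactly this solution.  Each
   step of the algorithm is thus an Euler step for P' = F(P),
   F(P) = A'^T P + P A' - P G P + Q, with F(Ps) = 0 for Ps = P*.

   Convergence is proved by comparison with multiples of Ps, in the Loewner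
   order.  For theta in [0, 1], F(theta Ps) >= (1 - theta) Q, and completing the
   square shows that an Euler step preserves P >= theta Ps while moving theta
   towards 1; for the upper bound, Ps is a Lyapunov function of the closed loop
   A' - G Ps.  Hence (1 - e) Ps <= P <= (1 + c) Ps is preserved with
   e := (1 - beta gamma) e + C gamma^2 and likewise for c.  For small steps this
   excludes further resets, and both sequences tend to 0 since gamma_k tends to 0
   and the gamma_k are not summable. *)

Require Import Defs.
From HB Require Import structures.
From mathcomp Require Import all_boot all_order all_algebra.
From mathcomp Require Import all_classical all_reals all_analysis.
From mathcomp Require Import measurable_realfun ring lra.
From mathcomp Require complex mxtens.

Set Implicit Arguments.
Unset Strict Implicit.
Unset Printing Implicit Defensive.

Import Order.TTheory GRing.Theory Num.Theory.
Import numFieldNormedType.Exports.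

Local Open Scope classical_set_scope.
Local Open Scope ring_scope.

(** * Quadratic forms *)

Section QuadraticForms.
Context {R : realType}.

(** The discounted second moment of the control makes [V] only locally integrable, so [X] need not
    have a derivative at every time. Its differential equation is therefore kept in integrated form
    ([primitive_on]), and the product rule for that form is Fubini's theorem on a triangle. Taking
    expectations in the state equation requires integrability over each [[0, T]]: of [u], by its
    discounted second moment; of [W], by a Gaussian first moment bound; of [x], for which no moment
    is assumed, by Gronwall along each path.

    On the Riccati side every estimate is an inequality of quadratic forms measured against [Ps].
    The second-order remainder of an Euler step is at most a constant times [g ^+ 2] times [Ps],
    with one constant for a whole band, because a band is bounded in norm. A band of lower width 1
    consists of the semidefinite matrices below a multiple of [Ps]. Every bounded set of
    semidefinite matrices lies in such a band, so the argument can start from any [P0], however far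
    from [Ps]. *)

Definition bform m n (S : 'M[R]_(m, n)) (x : 'cV[R]_m) (y : 'cV[R]_n) : R :=
  (x^T *m S *m y) 0 0.

Lemma bformDl m n (S T : 'M[R]_(m, n)) x y :
  bform (S + T) x y = bform S x y + bform T x y.
Proof. by rewrite /bform mulmxDr mulmxDl mxE. Qed.

Lemma bformZl m n a (S : 'M[R]_(m, n)) x y :
  bform (a *: S) x y = a * bform S x y.
Proof. by rewrite /bform -scalemxAr -scalemxAl mxE. Qed.

Lemma bformNl m n (S : 'M[R]_(m, n)) x y : bform (- S) x y = - bform S x y.
Proof. by rewrite -scaleN1r bformZl mulN1r. Qed.

Lemma bformDm m n (S : 'M[R]_(m, n)) x1 x2 y :
  bform S (x1 + x2) y = bform S x1 y + bform S x2 y.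
Proof. by rewrite /bform linearD /= !mulmxDl mxE. Qed.

Lemma bformZm m n a (S : 'M[R]_(m, n)) x y :
  bform S (a *: x) y = a * bform S x y.
Proof. by rewrite /bform linearZ /= -!scalemxAl mxE. Qed.

Lemma bformDr m n (S : 'M[R]_(m, n)) x y1 y2 :
  bform S x (y1 + y2) = bform S x y1 + bform S x y2.
Proof. by rewrite /bform mulmxDr mxE. Qed.

Lemma bformZr m n a (S : 'M[R]_(m, n)) x y :
  bform S x (a *: y) = a * bform S x y.
Proof. by rewrite /bform -scalemxAr mxE. Qed.

Lemma bformBl m n (S T : 'M[R]_(m, n)) x y :
  bform (S - T) x y = bform S x y - bform T x y.
Proof. by rewrite bformDl bformNl. Qed.

Lemma bformBm m n (S : 'M[R]_(m, n)) x1 x2 y :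
  bform S (x1 - x2) y = bform S x1 y - bform S x2 y.
Proof. by rewrite -scaleN1r bformDm bformZm mulN1r. Qed.

Lemma bformBr m n (S : 'M[R]_(m, n)) x y1 y2 :
  bform S x (y1 - y2) = bform S x y1 - bform S x y2.
Proof. by rewrite -scaleN1r bformDr bformZr mulN1r. Qed.

Lemma bform_tr m n (S : 'M[R]_(m, n)) x y : bform S^T y x = bform S x y.
Proof.
rewrite /bform; have -> : x^T *m S *m y = (y^T *m S^T *m x)^T.
  by rewrite !trmx_mul !trmxK mulmxA.
by rewrite [RHS]mxE.
Qed.

Lemma bform_sym n (S : 'M[R]_n) x y : S^T = S -> bform S x y = bform S y x.
Proof. by move=> SS; rewrite -bform_tr SS. Qed.

Lemma bform_mull m n k (L : 'M[R]_(m, k)) (S : 'M[R]_(k, n)) x y :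
  bform (L *m S) x y = bform S (L^T *m x) y.
Proof. by rewrite /bform trmx_mul trmxK !mulmxA. Qed.

Lemma bform_mulr m n k (S : 'M[R]_(m, k)) (L : 'M[R]_(k, n)) x y :
  bform (S *m L) x y = bform S x (L *m y).
Proof. by rewrite /bform !mulmxA. Qed.

Lemma bformE m n (S : 'M[R]_(m, n)) x y :
  bform S x y = \sum_i \sum_j x i 0 * S i j * y j 0.
Proof.
rewrite /bform mxE exchange_big /=; apply: eq_bigr => j _.
by rewrite mxE big_distrl /=; apply: eq_bigr => i _; rewrite mxE.
Qed.

Lemma bform1 n (x : 'cV[R]_n) : bform 1%:M x x = sqnorm x.
Proof. by rewrite /bform mulmx1 mxE; apply: eq_bigr => i _; rewrite mxE expr2. Qed.

Lemma sqnorm_ge0 n (x : 'cV[R]_n) : 0 <= sqnorm x.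
Proof. by apply: sumr_ge0 => i _; exact: sqr_ge0. Qed.

Lemma sqnorm_eq0 n (x : 'cV[R]_n) : (sqnorm x == 0) = (x == 0).
Proof.
apply/eqP/eqP => [|->]; last by rewrite /sqnorm big1// => i _; rewrite mxE expr0n.
move/eqP; rewrite psumr_eq0; last by move=> i _; exact: sqr_ge0.
move=> /allP x0; apply/matrixP => i j; rewrite ord1 mxE.
by have := x0 i (mem_index_enum _); rewrite sqrf_eq0 => /eqP.
Qed.

Lemma mx_entry_le m n (S : 'M[R]_(m, n)) i j : `|S i j| <= `|S|.
Proof.
rewrite [leRHS]/Num.norm /= mx_normrE.
exact: (le_bigmax_cond _ (fun ij : 'I_m * 'I_n => `|S ij.1 ij.2|) (j := (i, j))).
Qed.

Lemma mx_norm_leP m n (S : 'M[R]_(m, n)) c :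
  0 <= c -> (forall i j, `|S i j| <= c) -> `|S| <= c.
Proof.
move=> c0 Sc; rewrite [leLHS]/Num.norm /= mx_normrE.
by apply: bigmax_le => // -[i j] _ /=.
Qed.

Lemma mx_norm_tr m n (S : 'M[R]_(m, n)) : `|S^T| = `|S|.
Proof.
apply/le_anti/andP; split; apply: mx_norm_leP => // i j.
  by rewrite mxE mx_entry_le.
by have := mx_entry_le S^T j i; rewrite mxE.
Qed.

Lemma mx_norm_mul m n k (S : 'M[R]_(m, n)) (T : 'M[R]_(n, k)) :
  `|S *m T| <= n%:R * (`|S| * `|T|).
Proof.
apply: mx_norm_leP => [|i j]; first by rewrite !mulr_ge0.
rewrite mxE (le_trans (ler_norm_sum _ _ _))//.
rewrite (le_trans (ler_sum _ (G := fun=> `|S| * `|T|) _))//.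
  by move=> l _; rewrite normrM ler_pM ?mx_entry_le.
by rewrite sumr_const card_ord mulr_natl.
Qed.

(** A product of two coordinates is at most the mean of their squares; [|S|] is the largest absolute
    value of an entry, so the double sum costs a factor [n]. *)
Lemma bform_le_norm n (S : 'M[R]_n) x :
  `|bform S x x| <= n%:R * `|S| * sqnorm x.
Proof.
rewrite bformE (le_trans (ler_norm_sum _ _ _))//.
apply: (@le_trans _ _ (\sum_(i < n) \sum_(j < n)
    `|S| * ((x i 0 ^+ 2 + x j 0 ^+ 2) / 2))).
  apply: ler_sum => i _; rewrite (le_trans (ler_norm_sum _ _ _))//.
  apply: ler_sum => j _; rewrite !normrM mulrAC mulrC ler_pM ?mx_entry_le//.

  rewrite -(real_normK (num_real (x i 0))) -(real_normK (num_real (x j 0))).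
  by have := sqr_ge0 (`|x i 0| - `|x j 0|); lra.
under eq_bigr do rewrite -mulr_sumr -mulr_suml big_split /= sumr_const card_ord.
rewrite -mulr_sumr -mulr_suml big_split /= sumr_const card_ord sumrMnl.
rewrite -/(sqnorm x) -mulr2n -[_ *+ 2]mulr_natr mulfK ?pnatr_eq0//.
by rewrite -[_ *+ n]mulr_natl mulrCA mulrA.
Qed.

Lemma posdef_ge0 n (S : 'M[R]_n) x : posdef S -> 0 <= bform S x x.
Proof.
case=> _ Sp; have [->|/Sp/ltW//] := eqVneq x 0.
by rewrite /bform mulmx0 mxE.
Qed.

Lemma continuous_bform n (S : 'M[R]_n) :
  continuous (fun v : 'rV[R]_n => bform S v^T v^T).
Proof.
have -> : (fun v : 'rV[R]_n => bform S v^T v^T) =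
    (fun v => \sum_(ij <- enum {: 'I_n * 'I_n}) v 0 ij.1 * S ij.1 ij.2 * v 0 ij.2).
  apply/funext => w; rewrite bformE big_enum /= pair_big /=.
  by apply: eq_bigr => -[i j] _ /=; rewrite !mxE.
apply: continuous_big => [|[i j] _ v]; first exact: add_continuous.
apply: (@continuousM _ _ (fun w : 'rV[R]_n => w 0 i * S i j) (fun w => w 0 j)).
  apply: (@continuousM _ _ (fun w : 'rV[R]_n => w 0 i) (fun=> S i j)).
    exact: coord_continuous.
  exact: cst_continuous.
exact: coord_continuous.
Qed.

Lemma bform_normalize n (S : 'M[R]_n) x (y := (Num.sqrt (sqnorm x))^-1 *: x) :
  bform S y y = bform S x x / sqnorm x.
Proof.
rewrite bformZm bformZr mulrA -invfM -expr2 sqr_sqrtr ?sqnorm_ge0//.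
exact: mulrC.
Qed.

(** The form attains a minimum on the compact unit sphere, positive by definiteness, and homogeneity
    does the rest. *)
Lemma posdef_coercive n (S : 'M[R]_n) : posdef S ->
  exists2 c, 0 < c & forall x, c * sqnorm x <= bform S x x.
Proof.
move=> Spd; pose A := [set v : 'rV[R]_n | sqnorm v^T = 1].
(* The sphere is empty only in dimension 0, where 0 is the only vector and any constant serves. *)
have [[v0 Av0]|A0] := pselect (A !=set0); last first.
  exists 1 => // x; rewrite mul1r.
  suff -> : x = 0.
    by rewrite /bform mulmx0 mxE /sqnorm big1// => i _; rewrite mxE expr0n.
  apply/eqP/negPn/negP => x0; apply: A0.
  have s0 : 0 < sqnorm x by rewrite lt_neqAle sqnorm_ge0 eq_sym sqnorm_eq0 x0.
  exists ((Num.sqrt (sqnorm x))^-1 *: x^T); rewrite /A /=.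
  by rewrite linearZ /= trmxK -bform1 bform_normalize bform1 mulfV// gt_eqF.
have [v Av vmin] : exists2 v, v \in A & forall w, w \in A ->
    bform S v^T v^T <= bform S w^T w^T.
  apply: compact_EVT_min; first by exists v0.
    apply: bounded_closed_compact.
      exists 1; split=> // M M1 v /= Av; apply: mx_norm_leP => [|i j].
        by rewrite (le_trans _ (ltW M1)).
      rewrite (le_trans _ (ltW M1))// -(@expr_le1 _ 2)// real_normK ?num_real//.
      rewrite -Av /sqnorm (bigD1 j)//= !mxE !ord1 lerDl.
      by apply: sumr_ge0 => *; exact: sqr_ge0.
    rewrite (_ : A = (fun v : 'rV[R]_n => bform 1%:M v^T v^T) @^-1` [set 1]).
      by apply: closed_comp; [move=> *; exact: continuous_bform|exact: closed_eq].
    by apply/seteqP; split=> v; rewrite /A /= bform1.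
  by apply: continuous_subspaceT; exact: continuous_bform.
exists (bform S v^T v^T).
  apply: Spd.2; apply/eqP => v00; move: Av; rewrite inE /A /= v00.
  by rewrite /sqnorm big1 => [/esym/eqP|i _]; rewrite ?oner_eq0// mxE expr0n.
move=> x; have [->|x0] := eqVneq x 0.
  by rewrite [leRHS]/bform mulmx0 mxE /sqnorm big1 ?mulr0// => i _; rewrite mxE expr0n.
have s0 : 0 < sqnorm x by rewrite lt_neqAle sqnorm_ge0 eq_sym sqnorm_eq0 x0.
have := vmin ((Num.sqrt (sqnorm x))^-1 *: x^T).
rewrite !linearZ /= trmxK bform_normalize ler_pdivlMr// => -> //.
rewrite inE /A /= linearZ /= trmxK -bform1 bform_normalize bform1.
by rewrite mulfV// gt_eqF.
Qed.

(** This makes [S] a yardstick for all quadratic forms; the Riccati estimates use it with [Ps]. The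
    [+ 1] in the constant keeps it positive when [n = 0]. *)
Lemma posdef_dominates n (S : 'M[R]_n) : posdef S ->
  exists2 c, 0 < c & forall (T : 'M[R]_n) x,
    `|bform T x x| <= c * `|T| * bform S x x.
Proof.
move=> /posdef_coercive[c c0 cS]; exists ((n%:R + 1) / c).
  by rewrite divr_gt0// ltr_wpDl.
move=> T x; apply: le_trans (bform_le_norm T x) _.
rewrite -[leLHS]mulrA mulrAC -[leRHS]mulrA.
apply: (@le_trans _ _ ((n%:R + 1) * (`|T| * sqnorm x))).
  by apply: ler_wpM2r; rewrite ?mulr_ge0 ?sqnorm_ge0// lerDl.
rewrite mulrAC -[leRHS]mulrA ler_wpM2l ?addr_ge0//.
by rewrite ler_pdivlMr// -mulrA [leRHS]mulrC ler_wpM2l// mulrC.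
Qed.

Lemma bform_delta n (S : 'M[R]_n) i j :
  bform S (delta_mx i 0) (delta_mx j 0) = S i j.
Proof. by rewrite /bform trmx_delta -rowE -colE !mxE. Qed.

(** Polarization on basis vectors: an entry is recovered from the form at [x + y] and at [x - y],
    whose square norms add up to 4. *)
Lemma sym_norm_le n (S : 'M[R]_n) c : S^T = S -> 0 <= c ->
  (forall x, `|bform S x x| <= c * sqnorm x) -> `|S| <= 2 * c.
Proof.
move=> Ss c0 Sc; apply: mx_norm_leP => [|i j]; first by rewrite mulr_ge0.
rewrite -bform_delta; set x := delta_mx i 0; set y := delta_mx j 0.
have s1 (k : 'I_n) : sqnorm (delta_mx k 0 : 'cV[R]_n) = 1.
  by rewrite -bform1 bform_delta mxE eqxx.
have := Sc (x + y); have := Sc (x + (-1) *: y).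
rewrite -!bform1 !(bformDm, bformDr, bformZm, bformZr) !(bform1, s1).
rewrite (bform_sym y x Ss) (bform_sym y x (tr_scalar_mx _ _)).
move: (bform S x x) (bform S y y) (bform S x y) (bform 1%:M x y) => a b d e.
by rewrite !ler_norml; lra.
Qed.

End QuadraticForms.

(** * The Riccati iteration *)

Section Riccati.
Context {R : realType} {n : nat}.
Variables (A G Q Ps : 'M[R]_n).
Hypotheses (Gsym : G^T = G) (Gpos : forall x, 0 <= bform G x x).
Hypotheses (Qpd : posdef Q) (Pspd : posdef Ps).

(** The discount is absorbed later by taking [A - (rho / 2)%:M] for [A]: half of [rho *: P] comes
    from each of the first two terms. *)
Definition riccati (P : 'M[R]_n) : 'M[R]_n :=
  A^T *m P + P *m A - P *m G *m P + Q.

Hypothesis Ps0 : riccati Ps = 0.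

Lemma riccati_sym P : P^T = P -> (riccati P)^T = riccati P.
Proof.
move=> Psym; rewrite /riccati !linearD /= linearN /= !trmx_mul trmxK.
by rewrite Psym Gsym Qpd.1 mulmxA [P *m A + _]addrC.
Qed.

Let GE (S T : 'M[R]_n) x : S^T = S ->
  bform S x (G *m (T *m x)) = bform G (S *m x) (T *m x).
Proof. by move=> Ss; rewrite -bform_mulr bform_mull Ss. Qed.

Lemma bform_riccati P x : P^T = P ->
  bform (riccati P) x x =
  2 * bform P x (A *m x) - bform G (P *m x) (P *m x) + bform Q x x.
Proof.
move=> Psym; rewrite /riccati !bformDl bformNl bform_mull trmxK.
rewrite !bform_mulr GE// (bform_sym (A *m x) x Psym); ring.
Qed.

Let are x : bform Ps x (A *m x) =
  (bform G (Ps *m x) (Ps *m x) - bform Q x x) / 2.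
Proof.
have := bform_riccati x Pspd.1; rewrite Ps0 [LHS]/bform mulmx0 mul0mx mxE.
by lra.
Qed.

(* Completing the square around [theta *: Ps], a subsolution of the Riccati
   equation when [0 <= theta <= 1]. *)
Lemma riccati_step_lower P theta g x
    (L := A - theta *: (G *m Ps) - 2^-1 *: (G *m (P - theta *: Ps)))
    (E := P - theta *: Ps) : P^T = P ->
  bform (P + g *: riccati P) x x =
    theta * bform Ps x x + bform E (x + g *: (L *m x)) (x + g *: (L *m x))
    - g ^+ 2 * bform E (L *m x) (L *m x)
    + g * (1 - theta) * (bform Q x x + theta * bform G (Ps *m x) (Ps *m x)).
Proof.
move=> Psym; have Pss := Pspd.1.
have Esym : E^T = E by rewrite /E linearB linearZ /= Psym Pss.
rewrite bformDl bformZl bform_riccati// bformDm !bformDr !bformZm !bformZr.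
rewrite (bform_sym (L *m x) x Esym).
(* The half in [L] shares the quadratic term [E *m G *m E] evenly between [L^T *m E] and
   [E *m L]. *)
have -> : bform E x (L *m x) = bform P x (A *m x)
    - theta * bform Ps x (A *m x) - bform G (P *m x) (P *m x) / 2
    + theta ^+ 2 * bform G (Ps *m x) (Ps *m x) / 2.
  rewrite /L /E !mulmxBl -!scalemxAl -!mulmxA !mulmxBl -!scalemxAl.
  rewrite mulmxBr -scalemxAr !(bformBl, bformBr, bformZl, bformZr).
  rewrite !GE// (bform_sym (Ps *m x) (P *m x) Gsym).
  by field.
have -> : bform E x x = bform P x x - theta * bform Ps x x.
  by rewrite bformBl bformZl.
by rewrite are; field.
Qed.

(** Around [Ps] the matrix [L] is the closed loop, free of [P]. What is left of the quadratic term
    is [- g * bform G (E *m x) (E *m x)], which has the right sign for an upper bound. *)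
Lemma riccati_step_upper P g x (L := A - G *m Ps) (E := P - Ps) : P^T = P ->
  bform (P + g *: riccati P) x x =
    bform Ps x x + bform E (x + g *: (L *m x)) (x + g *: (L *m x))
    - g ^+ 2 * bform E (L *m x) (L *m x) - g * bform G (E *m x) (E *m x).
Proof.
move=> Psym; have Pss := Pspd.1.
have Esym : E^T = E by rewrite /E linearB /= Psym Pss.
rewrite bformDl bformZl bform_riccati// bformDm !bformDr !bformZm !bformZr.
rewrite (bform_sym (L *m x) x Esym).
have -> : bform E x (L *m x) = bform P x (A *m x) - bform Ps x (A *m x)
    - bform G (P *m x) (Ps *m x) + bform G (Ps *m x) (Ps *m x).
  rewrite /L /E !mulmxBl -!mulmxA.
  by rewrite !(bformBl, bformBr) !GE//; ring.
have -> : bform G (E *m x) (E *m x) = bform G (P *m x) (P *m x)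
    - 2 * bform G (P *m x) (Ps *m x) + bform G (Ps *m x) (Ps *m x).
  rewrite /E mulmxBl !(bformBm, bformBr).
  by rewrite (bform_sym (Ps *m x) (P *m x) Gsym); ring.
have -> : bform E x x = bform P x x - bform Ps x x by rewrite bformBl.
by rewrite are; field.
Qed.

(** The Riccati equation for [Ps] reads L^T Ps + Ps L = - Q - Ps G Ps, and this is the term of first
    order in [g]. *)
Lemma closed_loop_lyapunov g x (L := A - G *m Ps) :
  bform Ps (x + g *: (L *m x)) (x + g *: (L *m x)) =
    bform Ps x x - g * (bform Q x x + bform G (Ps *m x) (Ps *m x))
    + g ^+ 2 * bform Ps (L *m x) (L *m x).
Proof.
have Pss := Pspd.1.
rewrite bformDm !bformDr !bformZm !bformZr (bform_sym (L *m x) x Pss).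
have -> : bform Ps x (L *m x) = bform Ps x (A *m x)
    - bform G (Ps *m x) (Ps *m x).
  by rewrite /L mulmxBl -!mulmxA bformBr GE//; ring.
by rewrite are; field.
Qed.

(** Relative widths below and above [Ps]. For [e = 1] the lower bound says that [P] is positive
    semidefinite, which membership in a truncation set guarantees. *)
Definition band e c (P : 'M[R]_n) : Prop := P^T = P /\
  forall x, (1 - e) * bform Ps x x <= bform P x x <= (1 + c) * bform Ps x x.

Lemma band_bounded cmax : 0 <= cmax ->
  exists2 b, 0 <= b & forall P, band 1 cmax P -> `|P| <= b.
Proof.
move=> cmax0; exists (2 * ((1 + cmax) * (n%:R * `|Ps|))).
  by rewrite !mulr_ge0 ?addr_ge0.
move=> P [Psym PB]; apply: sym_norm_le => // [|x].
  by rewrite !mulr_ge0 ?addr_ge0.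
have /andP[] := PB x; rewrite subrr mul0r => P0 Pc.
rewrite ger0_norm// (le_trans Pc)// -mulrA ler_wpM2l ?addr_ge0//.
by rewrite (le_trans (ler_norm _))// bform_le_norm.
Qed.

(** Serves for the second-order term [g ^+ 2 * bform E (L *m x) (L *m x)] of an Euler step; the
    constant depends on [Ps] and [n] only. *)
Let bform_conj_le : exists2 k, 0 < k & forall l d (L E : 'M[R]_n) x,
  `|L| <= l -> `|E| <= d ->
  `|bform E (L *m x) (L *m x)| <= k * (l * (d * l)) * bform Ps x x.
Proof.
have [k k0 kP] := posdef_dominates Pspd.
exists (k * n%:R ^+ 2 + 1) => [|l d L E x Ll Ed].
  by rewrite ltr_wpDl// mulr_ge0// ltW.
have l0 := le_trans (normr_ge0 _) Ll; have d0 := le_trans (normr_ge0 _) Ed.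
have -> : bform E (L *m x) (L *m x) = bform (L^T *m (E *m L)) x x.
  by rewrite bform_mull trmxK bform_mulr.
apply: le_trans (kP _ _) _; apply: ler_wpM2r; first exact: posdef_ge0.
rewrite mulrDl mul1r -[leLHS]addr0 lerD ?mulr_ge0// -[leRHS]mulrA.
apply: ler_wpM2l; first exact: ltW.
apply: le_trans (mx_norm_mul _ _) _; rewrite expr2 -[leRHS]mulrA ler_wpM2l//.
rewrite mulrCA mx_norm_tr ler_pM// ?mulr_ge0//.
by apply: le_trans (mx_norm_mul _ _) _; rewrite ler_wpM2l// ler_pM.
Qed.

Variable beta : R.
Hypothesis betaQ : forall x, beta * bform Ps x x <= bform Q x x.

(** Both widths contract at rate [beta], up to order [g ^+ 2]: below because theta Ps with theta = 1
    - e gains at least g e Q in a step, above because [Ps] loses at least g Q along the closed loop.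
    One [C] must serve every [P] in the band, so [cmax] is fixed first: it bounds [P], hence [E] by
    [d] and [L] by [l]. *)
Lemma band_step cmax : 0 <= cmax ->
  exists2 C, 0 <= C & forall e c g P,
    0 <= e <= 1 -> 0 <= c <= cmax -> 0 <= g -> band e c P ->
    band ((1 - beta * g) * e + C * g ^+ 2)
         ((1 - beta * g) * c + C * g ^+ 2) (P + g *: riccati P).
Proof.
move=> cmax0; have [b b0 bP] := band_bounded cmax0.
have [k k0 kP] := bform_conj_le.
pose d := b + `|Ps|; pose l := `|A| + `|G *m Ps| + n%:R * (`|G| * d).
have d0 : 0 <= d by rewrite addr_ge0.
have l0 : 0 <= l by rewrite !(addr_ge0, mulr_ge0).
have C0 : 0 <= k * (l * (d * l)) by rewrite !mulr_ge0// ltW.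
(* The factor [1 + cmax] is for the upper bound, where the remainder in [E] is joined by [c <= cmax]
   times a remainder in [Ps]. *)
exists (k * (l * (d * l)) * (1 + cmax)).
  by rewrite mulr_ge0// addr_ge0.
move=> e c g P /andP[e0 e1] /andP[c0 cc] g0 PB.
have s0 x := posdef_ge0 x Pspd.
have Psym := PB.1.
have Pb : `|P| <= b.
  apply: bP; split=> // x; have /andP[Pe Pc] := PB.2 x; apply/andP; split.
    by apply: le_trans Pe; rewrite ler_wpM2r// lerB.
  by apply: le_trans Pc _; rewrite ler_wpM2r// lerD2l.
have Ed t : 0 <= t <= 1 -> `|P - t *: Ps| <= d.
  move=> /andP[t0 t1]; rewrite (le_trans (ler_normB _ _))// lerD//.
  by rewrite normrZ ger0_norm// ler_piMl.
split; first by rewrite linearD linearZ /= Psym riccati_sym.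
move=> x; apply/andP; split.
- have e01 : 0 <= 1 - e <= 1 by rewrite subr_ge0 e1 lerBlDr lerDl.
  rewrite (riccati_step_lower (1 - e))//.
  set L := A - _ - _; set E := P - _.
  have Ll : `|L| <= l.
    rewrite (le_trans (ler_normB _ _))// lerD//.
      rewrite (le_trans (ler_normB _ _))// lerD// normrZ ger0_norm//.
        by rewrite ler_piMl// lerBlDr lerDl.
      by rewrite subr_ge0.
    apply: (@le_trans _ _ `|G *m E|).
      by rewrite normrZ ger0_norm// ler_piMl// invf_le1// ler1n.
    by rewrite (le_trans (mx_norm_mul _ _))// ler_wpM2l// ler_wpM2l// Ed.
  have EE : 0 <= bform E (x + g *: (L *m x)) (x + g *: (L *m x)).
    rewrite bformBl bformZl subr_ge0.
    by have /andP[] := PB.2 (x + g *: (L *m x)).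
  have := kP l d L E x Ll (Ed _ e01); rewrite ler_norml => /andP[_ LE].
  have := betaQ x; have := Gpos (Ps *m x); have := s0 x.
  move: EE LE; move: (bform E _ _) (bform E _ _) => E1 E2.
  move: C0; move: (k * (l * (d * l))) (bform G _ _) (bform Q _ _) (bform Ps _ _).
  move=> C gg qq ss C0 E10 E2C ss0 gg0 bq.
  have h1 : g ^+ 2 * E1 <= g ^+ 2 * (C * ss) by rewrite ler_wpM2l// exprn_ge0.
  have h2 : g ^+ 2 * (C * ss) <= g ^+ 2 * (C * ss) * (1 + cmax).
    by rewrite ler_peMr ?lerDl// !mulr_ge0// exprn_ge0.
  have h3 : g * e * (beta * ss) <= g * e * qq by rewrite ler_wpM2l// mulr_ge0.
  have h4 : 0 <= g * e * ((1 - e) * gg) by rewrite !mulr_ge0// subr_ge0.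
  by nra.
- rewrite riccati_step_upper//.
  set L := A - _; set E := P - _.
  have Ll : `|L| <= l.
    rewrite (le_trans (ler_normB _ _))// -[leLHS]addr0 lerD//.
    by rewrite !mulr_ge0.
  have Ed1 : `|E| <= d by rewrite /E -[Ps]scale1r Ed// ler01 lexx.
  (* The upper bound on [E] is used at the displaced vector, where [closed_loop_lyapunov] evaluates
     [Ps]. *)
  have EE : bform E (x + g *: (L *m x)) (x + g *: (L *m x)) <=
      c * bform Ps (x + g *: (L *m x)) (x + g *: (L *m x)).
    have /andP[_] := PB.2 (x + g *: (L *m x)).
    by rewrite /E bformBl; lra.
  have := kP l d L E x Ll Ed1; rewrite ler_norml => /andP[LE _].
  have := kP l d L Ps x Ll; rewrite lerDr => /(_ b0) /ler_normlW LP.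
  have := betaQ x; have := Gpos (Ps *m x); have := Gpos (E *m x); have := s0 x.
  move: EE LE LP; rewrite closed_loop_lyapunov -/L.
  move: (bform Ps (L *m x) _) (bform E _ _) (bform E _ _) => P2 E1 E2.
  move: C0; move: (k * (l * (d * l))) (bform G _ _) (bform G _ _).
  move: (bform Q _ _) (bform Ps _ _).
  move=> qq ss C gE gg C0 E1P E2C P2C ss0 gE0 gg0 bq.
  have h1 : - (g ^+ 2 * E1) <= g ^+ 2 * (C * ss).
    by rewrite -mulrN ler_wpM2l ?exprn_ge0//; lra.
  have h2 : g ^+ 2 * c * P2 <= g ^+ 2 * cmax * (C * ss).
    apply: (@le_trans _ _ (g ^+ 2 * c * (C * ss))).
      by rewrite ler_wpM2l// mulr_ge0// exprn_ge0.
    by rewrite ler_wpM2r ?mulr_ge0// ler_wpM2l// exprn_ge0.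
  have h3 : g * c * (beta * ss) <= g * c * qq by rewrite ler_wpM2l// mulr_ge0.
  have h4 : 0 <= g * c * gg by rewrite !mulr_ge0.
  have h5 : 0 <= g * gE by rewrite mulr_ge0.
  by nra.
Qed.

End Riccati.

(** * Scalar recursions with vanishing steps of infinite sum *)

Section Recursion.
Context {R : realType}.
Variables (g a : R ^nat) (beta C : R).
Hypotheses (beta0 : 0 < beta) (C0 : 0 <= C) (g0 : forall k, 0 < g k).
Hypothesis gcvg : g @ \oo --> 0.
Hypothesis gdiv : forall M, exists n, M <= series g n.
Hypothesis arec : forall k, a k.+1 <= (1 - beta * g k) * a k + C * g k ^+ 2.

Lemma small_steps eps : 0 < eps ->
  exists N, forall k, (N <= k)%N -> C * g k <= eps /\ beta * g k <= 1.
Proof.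
move=> eps0; have d0 : 0 < Num.min (eps / (C + 1)) beta^-1.
  by rewrite lt_min invr_gt0 beta0 divr_gt0// ltr_wpDl.
have /cvgrPdist_le/(_ _ d0)[N _ NP] := gcvg.
exists N => k /NP /=; rewrite sub0r normrN gtr0_norm// le_min => /andP[h1 h2].
split; last by rewrite mulrC -ler_pdivlMr// div1r.
move: h1; rewrite ler_pdivlMr ?ltr_wpDl//.
by apply: le_trans; rewrite mulrDr mulr1 mulrC lerDl ltW.
Qed.

(** Once [C * g k <= beta * (eps / 2)], the next excess over [eps / 2] is at most
    [1 - beta * g k <= expR (- (beta * g k))] times the current one. Hence it is bounded by [B]
    times the exponential of minus [beta] times a sum of steps, and that sum diverges. *)
Lemma recursion_eventually_small eps : 0 < eps ->
  exists N, forall k, (N <= k)%N -> a k <= eps.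
Proof.
move=> eps0; have e20 : 0 < eps / 2 by rewrite divr_gt0.
have [N0 N0P] := small_steps (mulr_gt0 beta0 e20).
pose S j := series g (N0 + j)%N - series g N0.
pose B := `|a N0 - eps / 2|.
have H j : a (N0 + j)%N - eps / 2 <= expR (- (beta * S j)) * B.
  elim: j => [|j IH].
    by rewrite addn0 /S addn0 subrr mulr0 oppr0 expR0 mul1r ler_norm.
  have [h1 h2] := N0P (N0 + j)%N (leq_addr _ _).
  set k := (N0 + j)%N in IH h1 h2 *; rewrite addnS -/k.
  have SE : S j.+1 = S j + g k by rewrite /S addnS seriesSr addrAC.
  have h3 : a k.+1 - eps / 2 <= (1 - beta * g k) * (a k - eps / 2).
    have := arec k; have := ler_wpM2r (ltW (g0 k)) h1; rewrite expr2; lra.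
  apply: (le_trans h3).
  apply: (@le_trans _ _ ((1 - beta * g k) * (expR (- (beta * S j)) * B))).
    by rewrite ler_wpM2l// subr_ge0.
  have -> : expR (- (beta * S j.+1)) = expR (- (beta * g k)) * expR (- (beta * S j)).
    by rewrite SE -expRD; congr expR; ring.
  have B0 : 0 <= B := normr_ge0 _.
  rewrite -mulrA ler_wpM2r// ?mulr_ge0 ?expR_ge0//.
  exact: expR_ge1Dx.
(* The target makes [beta * s] at least [B / (eps / 2)]; then [expR (beta * s) >= beta * s]
   suffices. *)
have [n nP] := gdiv (series g N0 + B / (eps / 2) / beta).
exists (N0 + n)%N => k kn; have kN : (N0 <= k)%N := leq_trans (leq_addr _ _) kn.
have := H (k - N0)%N; rewrite subnKC//; set s := S _.
have sge : B <= eps / 2 * (beta * s).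
  suff : B / (eps / 2) / beta <= s.
    by rewrite !ler_pdivrMr// => /le_trans; apply; rewrite mulrC [s * _]mulrC.
  rewrite /s /S subnKC// lerBrDl (le_trans nP)//.
  apply: (@nondecreasing_series _ g xpredT 0) => [i _ _|]; first exact: ltW.
  by apply: leq_trans kn; rewrite leq_addl.
suff : expR (- (beta * s)) * B <= eps / 2 by lra.
rewrite expRN mulrC ler_pdivrMr ?expR_gt0//; apply: le_trans sge _.
rewrite ler_wpM2l ?(ltW e20)//; apply: le_trans (expR_ge1Dx _).
by rewrite lerDr.
Qed.

End Recursion.

Section StepSizes.
Context {R : realType}.

Lemma step_sizes_cvg0 (g : R ^nat) : step_sizes g -> g @ \oo --> 0.
Proof.
move=> gs; have g0 := step_gt0 gs.
have /cvg_series_cvg_0 g20 : cvgn (series (fun k => g k ^+ 2)).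
  by apply: nnseries_is_cvg (step_sum2 gs) => i; exact: sqr_ge0.
apply/cvgrPdist_le => e e0; move/cvgrPdist_le : g20 => /(_ _ (exprn_gt0 2 e0)).
apply: filterS => k; rewrite !sub0r !normrN ger0_norm ?sqr_ge0// gtr0_norm//.
by rewrite ler_pXn2r ?nnegrE// ltW.
Qed.

(** The scalar recursion starts only after the last reset and once the steps are small, so
    divergence is needed for tails. *)
Lemma step_sizes_diverge (g : R ^nat) k : step_sizes g ->
  forall M, exists n, M <= series (fun j => g (k + j)%N) n.
Proof.
move=> gs M; apply: contrapT => nM; have g0 := step_gt0 gs.
have : (\sum_(0 <= k <oo) (g k)%:E <= (series g k + M)%:E)%E.
  apply: lime_le.
    by apply: is_cvg_nneseries => i _ _; rewrite lee_fin ltW.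
  apply: nearW => i; rewrite sumEFin lee_fin.
  apply: (@le_trans _ _ (series g (k + i)%N)).
    apply: (@nondecreasing_series _ g xpredT 0) => [? _ _|]; first exact: ltW.
    exact: leq_addl.
  rewrite /series /= [in leLHS](big_cat_nat (n := k)) ?leq_addr//= lerD2l.
  rewrite -{1}[k]add0n big_addn addKn.
  rewrite leNgt; apply/negP => iM; apply: nM; exists i.
  by rewrite /series /=; under eq_bigr do rewrite addnC; exact: ltW.
by rewrite (step_sum gs) leye_eq.
Qed.

End StepSizes.

(** * The Euler iteration for the Riccati equation, without and with truncations *)

Section ValueIteration.
Context {R : realType} {n : nat}.
Variables (A G Q Ps : 'M[R]_n).
Hypotheses (Gsym : G^T = G) (Gpos : forall x, 0 <= bform G x x).
Hypotheses (Qpd : posdef Q) (Pspd : posdef Ps).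
Hypothesis Ps0 : riccati A G Q Ps = 0.

(** Coercivity of [Q] against a norm bound for [Ps]; this [beta] is the contraction rate of the
    iteration. *)
Lemma posdef_compare : exists2 beta, 0 < beta &
  forall x, beta * bform Ps x x <= bform Q x x.
Proof.
have [c c0 cQ] := posdef_coercive Qpd.
have k0 : 0 < n%:R * `|Ps| + 1 by rewrite ltr_wpDl// mulr_ge0.
exists (c / (n%:R * `|Ps| + 1)) => [|x]; first by rewrite divr_gt0.
apply: le_trans (cQ x); rewrite -mulrA ler_wpM2l ?(ltW c0)//.
rewrite mulrC ler_pdivrMr// (le_trans (ler_norm _))//.
rewrite (le_trans (bform_le_norm _ _))// mulrC ler_wpM2l ?sqnorm_ge0//.
by rewrite lerDl.
Qed.

(** At width 1 the contraction term is [beta * g], which outweighs [C * g ^+ 2] as soon as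
    [g <= beta / (C + 1)]; [cmax >= 1] leaves the same room above. *)
Lemma band_invariant cmax : 1 <= cmax -> exists2 g0, 0 < g0 &
  forall g P, 0 <= g <= g0 -> band Ps 1 cmax P ->
    band Ps 1 cmax (P + g *: riccati A G Q P).
Proof.
move=> cmax1; have [beta beta0 betaQ] := posdef_compare.
have cmax0 : 0 <= cmax := le_trans ler01 cmax1.
have [C C0 CP] := band_step Gsym Gpos Qpd Pspd Ps0 betaQ cmax0.
exists (beta / (C + 1)); first by rewrite divr_gt0// ltr_wpDl.
move=> g P /andP[g0 gg] PB.
have Cg : C * g ^+ 2 <= beta * g.
  rewrite expr2 mulrA ler_wpM2r//; move: gg.
  rewrite ler_pdivlMr ?ltr_wpDl//; apply: le_trans.
  by rewrite mulrDr mulr1 mulrC lerDl.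
have := CP 1 cmax g P; rewrite ler01 !lexx cmax0 => /(_ isT isT g0 PB)[Psym PB'].
split=> // x; have s0 := posdef_ge0 x Pspd.
have /andP[h1 h2] := PB' x; apply/andP; split.
  by apply: le_trans h1; rewrite ler_wpM2r//; lra.
apply: le_trans h2 _; rewrite ler_wpM2r//.
have : beta * g <= beta * g * cmax by rewrite ler_peMr// mulr_ge0// ltW.
by lra.
Qed.

(** One scalar sequence drives both widths: the form of the error is at most [cmax * w j] times that
    of [Ps], and [sym_norm_le] turns this into a bound in norm. *)
Lemma band_cvg (P : nat -> 'M[R]_n) (w : R ^nat) cmax k0 :
  1 <= cmax ->
  (forall j, band Ps (w j) (cmax * w j) (P (k0 + j)%N)) ->
  (forall eps, 0 < eps -> exists N, forall k, (N <= k)%N -> w k <= eps) ->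
  P @ \oo --> Ps.
Proof.
move=> cmax1 PB w0; apply/cvgrPdist_le => eps eps0.
have cmax0 : 0 <= cmax := le_trans ler01 cmax1.
pose K := 2 * (cmax * (n%:R * `|Ps|)).
have K0 : 0 <= K by rewrite !mulr_ge0.
have [N NP] := w0 _ (divr_gt0 eps0 (ltr_wpDl K0 ltr01)).
exists (k0 + N)%N => // k /= kN.
have kk : (k0 <= k)%N := leq_trans (leq_addr _ _) kN.
have := PB (k - k0)%N; rewrite subnKC// => -[Psym PBx].
have := NP (k - k0)%N; rewrite leq_subRL// => /(_ kN).
move: (w _) PBx => v PBx we.
set e := eps / _ in we; have e0 : 0 <= e by rewrite divr_ge0 ?(ltW eps0)// addr_ge0.
apply: (@le_trans _ _ (K * e)); last first.
  by rewrite /e mulrA ler_pdivrMr ?ltr_wpDl// mulrC ler_wpM2l ?(ltW eps0)// lerDl.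
clearbody e; rewrite distrC /K -mulrA; apply: sym_norm_le => [||x].
- by rewrite linearB /= Psym Pspd.1.
- by rewrite !mulr_ge0.
have s0 := posdef_ge0 x Pspd.
have : cmax * e * bform Ps x x <= cmax * (n%:R * `|Ps|) * e * sqnorm x.
  rewrite [leRHS](_ : _ = cmax * e * (n%:R * `|Ps| * sqnorm x)); last by ring.
  rewrite ler_wpM2l ?mulr_ge0// (le_trans (ler_norm _))//.
  exact: bform_le_norm.
apply: le_trans; rewrite bformBl.
have /andP[h1 h2] := PBx x.
have h3 : v * bform Ps x x <= e * bform Ps x x by rewrite ler_wpM2r.
have h4 : e * bform Ps x x <= cmax * (e * bform Ps x x).
  by rewrite ler_peMl// mulr_ge0.
have h5 : cmax * (v * bform Ps x x) <= cmax * (e * bform Ps x x).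
  by rewrite ler_wpM2l.
by rewrite ler_norml; apply/andP; split; lra.
Qed.

Lemma riccati_euler_cvg (P : nat -> 'M[R]_n) (g : R ^nat) cmax k0 :
  step_sizes g -> 1 <= cmax ->
  (forall k, (k0 <= k)%N -> band Ps 1 cmax (P k)) ->
  (forall k, (k0 <= k)%N -> P k.+1 = P k + g k *: riccati A G Q (P k)) ->
  P @ \oo --> Ps.
Proof.
move=> gs cmax1 PB Prec; have [beta beta0 betaQ] := posdef_compare.
have cmax0 : 0 <= cmax := le_trans ler01 cmax1.
have [C C0 CP] := band_step Gsym Gpos Qpd Pspd Ps0 betaQ cmax0.
have g0 := step_gt0 gs.
have [N NP] := small_steps beta0 C0 g0 (step_sizes_cvg0 gs) beta0.
pose k1 := (k0 + N)%N; pose h j := g (k1 + j)%N.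
(* The lower width follows [band_step] with equality, from the value 1. From [k1] on,
   [C * h j <= beta] and [beta * h j <= 1], which keeps it in [[0, 1]], as [band_step] requires. *)
pose w := fix w j := if j is i.+1 then (1 - beta * h i) * w i + C * h i ^+ 2 else 1.
have hP j : C * h j <= beta /\ beta * h j <= 1.
  by apply: NP; rewrite /k1 -addnA addnCA leq_addr.
have w01 j : 0 <= w j <= 1.
  elim: j => [|j /andP[IH0 IH1]] /=; first by rewrite ler01 lexx.
  have [h1 h2] := hP j; have hj0 : 0 <= h j := ltW (g0 _).
  apply/andP; split.
    by rewrite addr_ge0 ?mulr_ge0 ?subr_ge0// exprn_ge0.
  have := ler_wpM2r hj0 h1.
  have : (1 - beta * h j) * w j <= 1 - beta * h j by rewrite ler_piMr// subr_ge0.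
  by rewrite expr2; lra.
apply: (@band_cvg P w cmax k1) => // [j|]; last first.
  apply: (recursion_eventually_small beta0 C0 (fun j => g0 (k1 + j)%N)) => //.
  - have := step_sizes_cvg0 gs; rewrite -(cvg_shiftn k1).
    by under eq_fun do rewrite addnC.
  - exact: step_sizes_diverge.
elim: j => [|j IH].
  by rewrite addn0 mulr1; apply: PB; rewrite leq_addr.
have [h1 h2] := hP j; have hj0 : 0 <= h j := ltW (g0 _).
have /andP[wj0 wj1] := w01 j.
have kk : (k0 <= k1 + j)%N by rewrite /k1 -addnA leq_addr.
rewrite addnS Prec//; have := CP (w j) (cmax * w j) (h j) (P (k1 + j)%N).
rewrite w01 mulr_ge0// ler_piMr// => /(_ isT isT hj0 IH)[Psym PBx].
split=> // x; have /andP[b1 b2] := PBx x; rewrite b1 /=.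
apply: le_trans b2 _; rewrite ler_wpM2r ?posdef_ge0// lerD2l.
(* As [cmax >= 1], the remainder is at most [cmax] times itself, so [cmax * w] is still a valid
   upper width. *)
rewrite mulrDr mulrCA lerD2l ler_peMl// mulr_ge0// exprn_ge0//.
Qed.

(* If resets occurred infinitely often, at some reset the steps would be small
   and the counter large, so that the band around [Ps] which contains [P0] is
   invariant and lies in the current truncation set: no later reset. *)
Lemma truncated_riccati_cvg (P0 : 'M[R]_n) (g : R ^nat)
    (D : nat -> set 'M[R]_n) (P : nat -> 'M[R]_n) (q : nat -> nat)
    (cand := fun k => P k + g k *: riccati A G Q (P k)) :
  posdef P0 -> step_sizes g -> truncations D -> P 0%N = P0 ->
  (forall k, ~ D (q k) (cand k) -> P k.+1 = P0 /\ q k.+1 = (q k).+1) ->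
  (forall k, D (q k) (cand k) -> P k.+1 = cand k /\ q k.+1 = q k) ->
  P @ \oo --> Ps.
Proof.
move=> P0pd gs Dt PP0 reset keep.
have [kap kap0 kapP] := posdef_dominates Pspd.
have psd_band S M : possemidef S -> `|S| <= M -> band Ps 1 (Num.max 1 (kap * M)) S.
  move=> [Ssym S0] SM; split=> // x; rewrite subrr mul0r S0/=.
  apply: le_trans (ler_norm _) _; apply: le_trans (kapP S x) _.
  rewrite ler_wpM2r ?posdef_ge0//; apply: (@le_trans _ _ (kap * M)).
    by rewrite ler_wpM2l// ltW.
  by rewrite -[leLHS]add0r lerD// le_max lexx orbT.
have Dpsd i S : D i S -> possemidef S.
  by move=> DS; have : (\bigcup_q D q) S by [exists i]; rewrite (trunc_lim Dt).
have P0psd : possemidef P0 by split=> [|x]; [case: P0pd|exact: posdef_ge0].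
have Ppsd k : possemidef (P k).
  elim: k => [|k IH]; first by rewrite PP0.
  have [Dk|nDk] := pselect (D (q k) (cand k)).
    by rewrite (keep k Dk).1; exact: Dpsd Dk.
  by rewrite (reset k nDk).1.
have qmono : {homo q : i j / (i <= j)%N}.
  apply: homo_leq => // [i j k|k]; first exact: leq_trans.
  have [Dk|nDk] := pselect (D (q k) (cand k)).
    by rewrite (keep k Dk).2.
  by rewrite (reset k nDk).2.
have Dmono i j : (i <= j)%N -> D i `<=` D j.
  move=> /subnKC <-; elim: (j - i)%N => [|k IH]; first by rewrite addn0.
  by rewrite addnS; apply: subset_trans IH _; exact: trunc_nested.
have [k1 k1P] : exists k1, forall k, (k1 <= k)%N -> D (q k) (cand k).
  apply: contrapT => nk1.
  have resets k1 : exists2 k, (k1 <= k)%N & ~ D (q k) (cand k).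
    apply: contrapT => nk; apply: nk1; exists k1 => k kk.
    by apply: contrapT => nDk; apply: nk; exists k.
  pose c0 := Num.max 1 (kap * `|P0|).
  have c01 : 1 <= c0 by rewrite le_max lexx.
  have c00 : 0 <= c0 := le_trans ler01 c01.
  have P0B : band Ps 1 c0 P0 := psd_band _ _ P0psd (lexx _).
  have [g0 g00 g0P] := band_invariant c01.
  have [b b0 bP] := band_bounded Ps c00.
  (* The uniform form of the limit of the [D q] enters here: the whole band must fit in one of
     them. *)
  have [qs qsP] : exists qs, [set S | band Ps 1 c0 S] `<=` D qs.
    apply: (trunc_lim_unif Dt).
      exists b; split=> [|M bM S /= /bP /le_trans]; first exact: num_real.
      by apply; exact: ltW.
    move=> S [Ssym SB]; split=> // x; have /andP[+ _] := SB x.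
    by rewrite subrr mul0r.
  have /cvgrPdist_le/(_ _ g00)[N _ NP] := step_sizes_cvg0 gs.
  have [kq kqP] : exists kq, (qs <= q kq)%N.
    elim: qs {qsP} => [|i [k ik]]; first by exists 0%N.
    have [l kl nDl] := resets k; exists l.+1.
    by rewrite (reset l nDl).2 ltnS (leq_trans ik)// qmono.
  have [l ml nDl] := resets (maxn kq N); move: ml; rewrite geq_max => /andP[ql Nl].
  have stay j : band Ps 1 c0 (P (l.+1 + j)%N) /\
      D (q (l.+1 + j)%N) (cand (l.+1 + j)%N).
    have nxt k : (l <= k)%N -> band Ps 1 c0 (P k) -> D (q k) (cand k).
      move=> lk PB; suff : D qs (cand k).
        apply: Dmono; apply: leq_trans kqP _; apply: qmono.
        exact: leq_trans lk.
      apply: qsP; apply: g0P => //; rewrite ltW ?(step_gt0 gs)//=.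
      have /= := NP k (leq_trans Nl lk).
      by rewrite sub0r normrN gtr0_norm ?(step_gt0 gs).
    suff PB : band Ps 1 c0 (P (l.+1 + j)%N).
      by split=> //; apply: nxt => //; rewrite addSnnS leq_addr.
    elim: j => [|j IH]; first by rewrite addn0 (reset l nDl).1.
    have lj : (l <= l.+1 + j)%N by rewrite addSnnS leq_addr.
    have Dj := nxt _ lj IH; rewrite addnS (keep _ Dj).1.
    apply: g0P => //; rewrite ltW ?(step_gt0 gs)//=.
    have /= := NP _ (leq_trans Nl lj).
    by rewrite sub0r normrN gtr0_norm ?(step_gt0 gs).
  have [k lk nDk] := resets l.+1; apply: nDk.
  by have [_] := stay (k - l.+1)%N; rewrite subnKC.
have qcst k : (k1 <= k)%N -> q k = q k1.
  move=> /subnKC <-; elim: (k - k1)%N => [|j IH]; first by rewrite addn0.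
  by rewrite addnS (keep _ (k1P _ (leq_addr _ _))).2.
(* The counter is now frozen, so the bounded set [D (q k1)] contains all later iterates. Only from
   [k1.+1] on is an iterate known to be an accepted candidate. *)
have [M [_ MP]] := trunc_bounded Dt (q k1).
apply: (@riccati_euler_cvg P g (Num.max 1 (kap * (M + 1))) k1.+1) => //.
- by rewrite le_max lexx.
- case=> // k kk; apply: psd_band => //.
  apply: (MP (M + 1)); first by rewrite ltrDl.
  by rewrite -(qcst k)// (keep _ (k1P k kk)).1; exact: k1P.
- by move=> k kk; rewrite (keep _ (k1P _ (ltnW kk))).1.
Qed.

End ValueIteration.

(** * Vectorizations and the data equation *)

Section Vectorization.
Context {R : realType}.

Lemma index_allpairs_pair (S T : eqType) (s : seq S) (t : seq T) x y :
  x \in s -> y \in t ->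
  index (x, y) [seq (a, b) | a <- s, b <- t] = (index x s * size t + index y t)%N.
Proof.
move=> + yt; elim: s => //= a s IH; rewrite inE index_cat.
have pinj : injective (pair a : T -> S * T) by move=> ? ? [].
have [->|xa /= xs] := eqVneq x a; first by rewrite (map_f (pair a))// index_map.
rewrite ifN; last by apply/mapP => -[b _ [xb]]; rewrite xb eqxx in xa.
by rewrite size_map IH// mulSn addnA.
Qed.

(** [mxvec_index] is defined through ranks in an enumeration. Its value is needed to identify it
    with the Kronecker index [mxtens_index]. *)
Lemma val_mxvec_index m n (i : 'I_m) (j : 'I_n) :
  val (mxvec_index i j) = (i * n + j)%N.
Proof.
have rankE (T : finType) (x : T) : val (enum_rank x) = index x (enum T).
  by rewrite -[in RHS](nth_enum_rank x x) index_uniq ?enum_uniq// -cardE.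
rewrite /mxvec_index /= rankE enumT unlock /= /prod_enum.
by rewrite index_allpairs_pair ?mem_enum// size_enum_ord !index_enum_ord.
Qed.

Lemma kronv_vec n m (x : 'cV[R]_n) (v : 'cV[R]_m) (N : 'M[R]_(m, n)) :
  ((kronv x v)^T *m vec N) 0 0 = bform N v x.
Proof.
rewrite mxE (reindex _ (curry_mxvec_bij n m)) /=.
rewrite bformE exchange_big pair_big /=; apply: eq_bigr => -[i j] _ /=.
rewrite /vec mxE [in X in _ * X]mxE mxvecE [in X in _ * X]mxE.
have -> : mxvec_index i j = mxtens.mxtens_index (i, j).
  by apply: val_inj; rewrite val_mxvec_index.
by rewrite [X in X * _]mxE mxtens.mxtens_indexK /= !ord1; ring.
Qed.

Lemma vec_inj m n : injective (@vec R m n).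
Proof.
by move=> S T /trmx_inj /(can_inj mxvecK) /trmx_inj.
Qed.

Lemma col_of_seq_dot (N : nat) (I : Type) (s : seq I) (f g : I -> R) :
  size s = N ->
  ((col_of_seq N [seq f i | i <- s])^T *m col_of_seq N [seq g i | i <- s]) 0 0
  = \sum_(i <- s) f i * g i.
Proof.
move=> <-; case: s => [|i0 s]; first by rewrite big_nil mxE big_ord0.
rewrite mxE (big_nth i0) big_mkord; apply: eq_bigr => k _.
by rewrite !mxE !(nth_map i0).
Qed.

Lemma quadv_vecs n (x : 'cV[R]_n) (S : 'M[R]_n) : S^T = S ->
  ((quadv x)^T *m vecs S) 0 0 = bform S x x.
Proof.
move=> Ssym; have SE i j : S i j = S j i by rewrite -[in LHS]Ssym mxE.
rewrite col_of_seq_dot ?size_upper_pairs// /upper_pairs big_allpairs_dep /=.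
rewrite bformE; pose F i j := x i 0 * S i j * x j 0.
have FE i j : F i j = F j i by rewrite /F SE; ring.
(* The coefficient 2 of an off-diagonal pair is spent as one copy over [i <= j] and one over
   [i < j]; by symmetry the latter is the sum below the diagonal. *)
transitivity (\sum_(i < n) (\sum_(j < n | (i <= j)%N) F i j
    + \sum_(j < n | (i < j)%N) F i j)).
  rewrite big_enum /=; apply: eq_bigr => i _.
  rewrite big_filter big_enum_cond /=.
  rewrite [X in _ = _ + X](_ : _ =
      \sum_(j < n | (i <= j)%N) if i == j then 0 else F i j).
    rewrite -big_split /=; apply: eq_bigr => j _.
    by rewrite /F; case: eqP => _; ring.
  rewrite [LHS]big_mkcond [RHS]big_mkcond /=; apply: eq_bigr => j _.
  by rewrite ltn_neqAle -val_eqE /=; case: eqP => //=; rewrite if_same.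
rewrite big_split /= [X in _ + X]pair_big_dep /=.
have -> : \sum_(i < n) \sum_(j < n) x i 0 * S i j * x j 0 =
    \sum_(i < n) \sum_(j < n | (i <= j)%N) F i j +
    \sum_(i < n) \sum_(j < n | ~~ (i <= j)%N) F i j.
  rewrite -big_split /=; apply: eq_bigr => i _.
  by rewrite (bigID (fun j : 'I_n => (i <= j)%N)).
congr (_ + _); rewrite [RHS](eq_bigr (fun i : 'I_n => \sum_(j < n | (j < i)%N) F j i)).
  rewrite -(pair_big_dep xpredT (fun i j : 'I_n => (i < j)%N) F) /=.
  by rewrite (exchange_big_dep xpredT).
by move=> i _; apply: eq_big => [j|j _]; rewrite ?ltnNge.
Qed.

(** Equal [vecs] give equal quadratic forms, and a symmetric matrix with zero form vanishes by
    [sym_norm_le] with [c = 0]. *)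
Lemma vecs_sym_inj n (S T : 'M[R]_n) :
  S^T = S -> T^T = T -> vecs S = vecs T -> S = T.
Proof.
move=> Ssym Tsym ST; apply/eqP; rewrite -subr_eq0 -normr_le0 -(mulr0 2).
apply: sym_norm_le => // [|x]; first by rewrite linearB /= Ssym Tsym.
by rewrite mul0r bformBl -!quadv_vecs// ST subrr normr0.
Qed.

Lemma pinv_mul a b (M : 'M[R]_(a, b)) : \rank M = b -> Defs.pinv M *m M = 1%:M.
Proof.
move=> rM; have Mt : row_free M^T by rewrite /row_free mxrank_tr rM.
have inj k (Y Z : 'M[R]_(b, k)) : M *m Y = M *m Z -> Y = Z.
  move=> /(congr1 trmx); rewrite !trmx_mul => /(row_free_inj Mt).
  exact: trmx_inj.
have Gu : M^T *m M \in unitmx.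
  rewrite -row_free_unit; apply: inj_row_free => v vM.
  apply: trmx_inj; apply: inj; rewrite trmx0 mulmx0.
  set w := M *m v^T; have : bform 1%:M w w = 0.
    by rewrite /bform mulmx1 /w trmx_mul trmxK mulmxA -[v *m _ *m M]mulmxA
      vM mul0mx mxE.
  by rewrite bform1 => /eqP; rewrite sqnorm_eq0 => /eqP.
have [h _ _ _] : is_pinv M (Defs.pinv M).
  apply: (xgetPex 0); exists (invmx (M^T *m M) *m M^T).
  have YM : invmx (M^T *m M) *m M^T *m M = 1%:M by rewrite -mulmxA mulVmx.
  split.
  - by rewrite -mulmxA YM mulmx1.
  - by rewrite YM mul1mx.
  - rewrite !trmx_mul trmxK trmx_inv trmx_mul trmxK -!mulmxA //.
  - by rewrite YM tr_scalar_mx.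
by apply: inj; rewrite mulmxA h mulmx1.
Qed.

End Vectorization.

(** * From the data equation to the Riccati iteration *)

Section DataDriven.
Context {R : realType} {n m d : nat}.
Variables (A : 'M[R]_n) (B : 'M[R]_(n, m)) (Qw : 'M[R]_n) (Rw : 'M[R]_m).
Variable rho : R.
Hypotheses (hQ : posdef Qw) (hR : posdef Rw).

Let At := A - (rho / 2)%:M.
Let G := B *m invmx Rw *m B^T.

Lemma posdef_unit k (S : 'M[R]_k) : posdef S -> S \in unitmx.
Proof.
move=> [_ Sp]; rewrite -row_free_unit; apply: inj_row_free => v vS.
apply/eqP/negPn/negP => v0; have := Sp v^T; rewrite trmxK vS mul0mx mxE ltxx.
have -> : v^T != 0 by apply: contraNneq v0 => /(congr1 trmx); rewrite trmxK trmx0 => ->.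
by move=> /(_ isT).
Qed.

Lemma feedback_sym : G^T = G.
Proof. by rewrite /G !trmx_mul trmxK trmx_inv hR.1 mulmxA. Qed.

Lemma feedback_ge0 x : 0 <= bform G x x.
Proof.
have Ru := posdef_unit hR.
rewrite /G -mulmxA bform_mull bform_mulr; set y := B^T *m x.
have -> : bform (invmx Rw) y y = bform Rw (invmx Rw *m y) (invmx Rw *m y).
  rewrite -[RHS]bform_mulr mulmxV// -[in LHS](mulmx1 (invmx Rw)).
  by rewrite bform_mull trmx_inv hR.1.
exact: posdef_ge0.
Qed.

Lemma riccati_shift P : riccati At G Qw P =
  P *m A + A^T *m P - rho *: P - P *m B *m invmx Rw *m B^T *m P + Qw.
Proof.
rewrite /riccati /At /G linearB /= tr_scalar_mx mulmxBl mulmxBr.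
rewrite mul_scalar_mx mul_mx_scalar !mulmxA; congr (_ - _ + _).
rewrite addrACA -opprD -scalerDl -splitr; congr (_ - _); exact: addrC.
Qed.

Variables (IX I : 'M[R]_(d, (n * n.+1)./2)) (IXV : 'M[R]_(d, n * m)).
Hypothesis hrank : \rank (row_mx IX IXV) = (m * n + (n * n.+1)./2)%N.
Hypothesis hdata : forall S, S^T = S ->
  I *m vecs S = IX *m vecs (S *m A + A^T *m S - rho *: S)
              + 2 *: (IXV *m vec (B^T *m S)).

Variables (P0 : 'M[R]_n) (gamma : nat -> R) (D : nat -> set 'M[R]_n).
Variables (P M : nat -> 'M[R]_n) (N K : nat -> 'M[R]_(m, n)) (q : nat -> nat).
Hypothesis hrun : value_iteration IX I IXV Qw Rw P0 gamma D P M N K q.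

Lemma data_solution k : (P k)^T = P k ->
  M k = P k *m A + A^T *m P k - rho *: P k /\ N k = B^T *m P k.
Proof.
move=> Psym; have rk : \rank (row_mx IX (2 *: IXV)) = ((n * n.+1)./2 + n * m)%N.
  (* The rank hypothesis concerns [IXV] and the algorithm uses [2 *: IXV]; the two block matrices
     differ by an invertible diagonal factor. *)
  pose Dm (a : R) : 'M[R]_((n * n.+1)./2 + n * m) := block_mx 1%:M 0 0 a%:M.
  have -> : row_mx IX (2 *: IXV) = row_mx IX IXV *m Dm 2.
    by rewrite mul_row_block !mulmx0 mulmx1 addr0 add0r mul_mx_scalar.
  rewrite mxrankMfree ?hrank 1?addnC 1?[(m * n)%N]mulnC// row_free_unit.
  suff /mulmx1_unit[] : Dm 2 *m Dm 2^-1 = 1%:M by [].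
  rewrite mulmx_block !mulmx0 !mul0mx !mulmx1 !addr0 add0r -scalar_mxM.
  by rewrite mulfV// -scalar_mx_block.
have Ms : (P k *m A + A^T *m P k - rho *: P k)^T =
    P k *m A + A^T *m P k - rho *: P k.
  rewrite linearB linearD linearZ /= !trmx_mul trmxK Psym.
  by rewrite [A^T *m _ + _]addrC.
have := vi_MN hrun k; rewrite -mulmxA (hdata Psym).
have -> : IX *m vecs (P k *m A + A^T *m P k - rho *: P k)
    + 2 *: (IXV *m vec (B^T *m P k)) = row_mx IX (2 *: IXV) *m
    col_mx (vecs (P k *m A + A^T *m P k - rho *: P k)) (vec (B^T *m P k)).
  by rewrite mul_row_col -scalemxAl.
rewrite mulmxA pinv_mul// mul1mx => /eq_col_mx[/vecs_sym_inj MM /vec_inj NN].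
by split=> //; apply: MM => //; exact: vi_symM hrun k.
Qed.

Lemma data_gain k : (P k)^T = P k -> K k = invmx Rw *m B^T *m P k.
Proof. by move=> /data_solution[_ NN]; rewrite (vi_K hrun) NN mulmxA. Qed.

Lemma data_candidate k : (P k)^T = P k ->
  candidate Qw Rw (gamma k) (P k) (M k) (K k) =
  P k + gamma k *: riccati At G Qw (P k).
Proof.
move=> Psym; have [MM _] := data_solution Psym.
have Ru := posdef_unit hR.
have KK : (K k)^T *m Rw *m K k = P k *m B *m invmx Rw *m B^T *m P k.
  rewrite data_gain// !trmx_mul trmxK trmx_inv hR.1 Psym !mulmxA.
  by rewrite -[_ *m Rw *m _]mulmxA mulmxV// mulmx1.
by rewrite /candidate KK MM riccati_shift.
Qed.

Lemma data_driven_cvg (Ps : 'M[R]_n) :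
  posdef Ps ->
  rho *: Ps = Ps *m A + A^T *m Ps - Ps *m B *m invmx Rw *m B^T *m Ps + Qw ->
  posdef P0 -> step_sizes gamma -> truncations D ->
  K @ \oo --> invmx Rw *m B^T *m Ps.
Proof.
move=> Pspd are P0pd gs Dt.
have ric0 : riccati At G Qw Ps = 0.
  have ac (a b c e : 'M[R]_n) : a - b - c + e = a - c + e - b.
    by rewrite -!addrA [- b + _]addrC -addrA.
  by rewrite riccati_shift ac -are subrr.
(* Symmetry comes first: the data equation is given for symmetric matrices, and identifies the
   candidate with an Euler step only for them. *)
have Psym k : (P k)^T = P k.
  elim: k => [|k IH]; first by rewrite (vi_P0 hrun) P0pd.1.
  have [/[dup] DD /(vi_keep hrun)[-> _]|/(vi_reset hrun)[-> _]] := pselect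
    (D (q k) (candidate Qw Rw (gamma k) (P k) (M k) (K k))).
    rewrite data_candidate// linearD linearZ /= riccati_sym ?IH//.
    exact: feedback_sym.
  exact: P0pd.1.
have cvgP : P @ \oo --> Ps.
  apply: (truncated_riccati_cvg feedback_sym feedback_ge0 hQ Pspd ric0
    P0pd gs Dt (q := q)).
  - exact: vi_P0 hrun.
  - by move=> k; rewrite -data_candidate//; exact: vi_reset hrun k.
  - by move=> k; rewrite -data_candidate//; exact: vi_keep hrun k.
rewrite (_ : K = fun k => invmx Rw *m B^T *m P k); last first.
  by apply/funext => k; rewrite data_gain.
set L := invmx Rw *m B^T.
apply/cvgrPdist_le => e e0; move/cvgrPdist_le : cvgP.
have c0 : 0 < n%:R * `|L| + 1 by rewrite ltr_wpDl// mulr_ge0.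
move=> /(_ _ (divr_gt0 e0 c0)); apply: filterS => k ke.
rewrite -mulmxBr (le_trans (mx_norm_mul _ _))// mulrA.
apply: (@le_trans _ _ ((n%:R * `|L| + 1) * `|Ps - P k|)).
  by rewrite ler_wpM2r// lerDl.
by rewrite mulrC -ler_pdivlMr.
Qed.

End DataDriven.

(** * Absolutely continuous functions *)

Section RealFubini.
Context d1 d2 (T1 : measurableType d1) (T2 : measurableType d2) (R : realType).
Variable m1 : {sigma_finite_measure set T1 -> \bar R}.
Variable m2 : {sigma_finite_measure set T2 -> \bar R}.
Variable f : T1 * T2 -> R.
Hypothesis imf : (m1 \x m2)%E.-integrable setT (EFin \o f).

(** [fine] sends infinities to 0, so real inner integrals are no larger in absolute value than
    extended ones. *)
Lemma integrable_Rfubini_F :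
  m1.-integrable setT (EFin \o (fun x => \int[m2]_y f (x, y))).
Proof.
apply: le_integrable (integrable_fubini_F imf) => //.
  by apply/measurable_EFinP; apply: measurableT_comp (measurable_fubini_F imf).
move=> x _ /=; rewrite /Rintegral /fubini_F /=.
by case: integral => [r||] //=; rewrite ?normr0 leey.
Qed.

Lemma integrable_Rfubini_G :
  m2.-integrable setT (EFin \o (fun y => \int[m1]_x f (x, y))).
Proof.
have mf : measurable_fun setT (EFin \o f) := measurable_int _ imf.
have mabs : measurable_fun setT (fun y => \int[m1]_x `|(f (x, y))%:E|)%E.
  apply: (measurable_fun_fubini_tonelli_G (abse \o (EFin \o f))).
    exact: measurableT_comp.
  by move=> z; exact: abse_ge0.
have iabs : m2.-integrable setT (fun y => \int[m1]_x `|(f (x, y))%:E|)%E.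
  apply/integrableP; split; first exact: mabs.
  under eq_integral do rewrite gee0_abs ?integral_ge0//.
  by have /(integrable21ltyP m1 m2 mf) := imf.
apply: le_integrable iabs => //.
  by apply/measurable_EFinP; apply: measurableT_comp (measurable_fubini_G imf).
move=> y _; rewrite [leRHS]gee0_abs ?integral_ge0//.
apply: (@le_trans _ _ `|\int[m1]_x (f (x, y))%:E|%E).
  by rewrite /= /Rintegral; case: integral => [r||] //=; rewrite ?normr0 leey.
apply: le_abse_integral => //.
by apply: measurableT_comp mf _; exact: measurable_pair2.
Qed.

(** Sections are integrable at almost every point; there the real and the extended inner integrals
    agree, and null sets do not affect the outer ones. *)
Lemma Rintegral_fubini :
  \int[m1]_x (\int[m2]_y f (x, y)) = \int[m2]_y (\int[m1]_x f (x, y)).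
Proof.
congr fine; transitivity (\int[m1]_x fubini_F m2 (EFin \o f) x)%E.
  apply: ae_eq_integral => //.
  - exact: measurable_int integrable_Rfubini_F.
  - exact: measurable_fubini_F imf.
  have := ae_integrable1 imf; apply: filterS => x ix _.
  by rewrite /= fineK// integrable_fin_num.
rewrite (integral12_prod_meas1 imf) -(integral21_prod_meas1 imf).
apply: ae_eq_integral => //.
- exact: measurable_fubini_G imf.
- exact: measurable_int integrable_Rfubini_G.
have := ae_integrable2 imf; apply: filterS => x ix _.
by rewrite /= fineK// integrable_fin_num.
Qed.

End RealFubini.

Lemma integrable_tensor d1 d2 (T1 : measurableType d1) (T2 : measurableType d2)
    (R : realType) (m1 : {sigma_finite_measure set T1 -> \bar R})
    (m2 : {sigma_finite_measure set T2 -> \bar R}) (f : T1 -> R) (g : T2 -> R) :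
  m1.-integrable setT (EFin \o f) -> m2.-integrable setT (EFin \o g) ->
  (m1 \x m2)%E.-integrable setT (EFin \o (fun z => f z.1 * g z.2)).
Proof.
move=> fi gi; have mf : measurable_fun setT f.
  exact/measurable_EFinP/(measurable_int m1).
have mg : measurable_fun setT g by exact/measurable_EFinP/(measurable_int m2).
apply/(integrable12ltyP m1 m2).
  apply/measurable_EFinP; apply: measurable_funM.
    exact: measurableT_comp.
  exact: measurableT_comp.
have /integrableP[_ gy] := gi; have /integrableP[_ fy] := fi.
have g0 : (0 <= \int[m2]_y `|(g y)%:E|)%E by exact: integral_ge0.
under eq_integral => x _.
  under eq_integral do rewrite /= normrM EFinM.
  rewrite ge0_integralZl//=; last first.
    by apply/measurable_EFinP; exact: measurableT_comp.
  over.
rewrite ge0_integralZr//=; last first.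
  by apply/measurable_EFinP; exact: measurableT_comp.
rewrite lte_mul_pinfty//; first exact: integral_ge0.
by rewrite ge0_fin_numE//; exact: integral_ge0.
Qed.

Lemma integrable_patch d (T : measurableType d) (R : realType)
    (m : {measure set T -> \bar R}) (A : set T) (h : T -> R) : measurable A ->
  m.-integrable A (EFin \o h) -> m.-integrable setT (EFin \o (h \_ A)).
Proof. by move=> mA; rewrite -restrict_EFin => /(integrable_mkcond _ mA). Qed.

Section ProductRule.
Context {R : realType}.
Notation mu := (@lebesgue_measure R).

Lemma primitive_tail (f : R -> R) a b x :
  mu.-integrable `[a, b] (EFin \o f) -> x \in `[a, b] ->
  \int[mu]_(t in `[x, b]) f t =
  \int[mu]_(t in `[a, b]) f t - \int[mu]_(t in `[a, x]) f t.
Proof.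
move=> fi; rewrite in_itv /= => /andP[ax xb].
rewrite (Rintegral_itvB fi) ?bnd_simp//; symmetry.
apply: Rintegral_itv_obnd_cbnd; apply: integrableS fi => //.
by apply: subset_itv; rewrite bnd_simp.
Qed.

Variables (a b : R) (f g : R -> R).
Hypotheses (fi : mu.-integrable `[a, b] (EFin \o f))
           (gi : mu.-integrable `[a, b] (EFin \o g)).

(** A kernel on a triangle: integrating one variable leaves [f] times the primitive of [g],
    integrating the other leaves [g] times the tail integral of [f]. *)
Let k (z : measurableTypeR R * measurableTypeR R) : R :=
  ((f \_ `[a, b]) z.1 * (g \_ `[a, b]) z.2) * (z.2 <= z.1)%R%:R.

Let ki : (mu \x mu)%E.-integrable setT (EFin \o k).
Proof.
have mab : measurable (`[a, b]%classic : set (measurableTypeR R)) by [].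
have kk := integrable_tensor (integrable_patch mab fi) (integrable_patch mab gi).
move: (kk); apply: le_integrable => //.
  apply/measurable_EFinP; apply: measurable_funM.
    by apply/measurable_EFinP; exact: measurable_int kk.
  apply: measurableT_comp => //.
  by apply: measurable_fun_ler; [exact: measurable_snd|exact: measurable_fst].
move=> z _ /=; by rewrite lee_fin normrM ler_piMr// normr_nat lern1 leq_b1.
Qed.

Let kF x : \int[mu]_y k (x, y) =
  ((fun t => f t * \int[mu]_(y in `[a, t]) g y) \_ `[a, b]) x.
Proof.
rewrite patchE; case: ifPn => xab; last first.
  under eq_Rintegral do rewrite /k patchE (negbTE xab) !mul0r.
  by rewrite Rintegral_cst ?mul0r.
have := xab; rewrite inE /= in_itv /= => /andP[ax xb].
have xsub : `[a, x] `<=` `[a, b] by apply: subset_itv; rewrite bnd_simp.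
rewrite [in RHS]Rintegral_mkcond -RintegralZl//; last first.
  by apply: integrable_patch => //; apply: integrableS gi.
apply: eq_Rintegral => y _; rewrite /k !patchE xab -mulrA; congr (_ * _).
case: ifPn => [|yab].
  rewrite inE /= in_itv /= => /andP[ay yb].
  have [yx|xy] := leP y x; first by rewrite mulr1 mem_set//= in_itv /= ay.
  by rewrite mulr0 memNset//= in_itv /= ay /= leNgt xy.
by rewrite mul0r memNset// => /xsub /mem_set; exact/negP.
Qed.

Let kG y : \int[mu]_x k (x, y) =
  ((fun t => g t * \int[mu]_(x in `[t, b]) f x) \_ `[a, b]) y.
Proof.
rewrite patchE; case: ifPn => yab; last first.
  under eq_Rintegral do rewrite /k [X in _ * X * _]patchE (negbTE yab) mulr0 mul0r.
  by rewrite Rintegral_cst ?mul0r.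
have := yab; rewrite inE /= in_itv /= => /andP[ay yb].
have ysub : `[y, b] `<=` `[a, b] by apply: subset_itv; rewrite bnd_simp.
rewrite [in RHS]Rintegral_mkcond -RintegralZl//; last first.
  by apply: integrable_patch => //; apply: integrableS fi.
apply: eq_Rintegral => x _; rewrite /k !patchE yab mulrAC mulrC; congr (_ * _).
case: ifPn => [|xab].
  rewrite inE /= in_itv /= => /andP[ax xb].
  have [yx|xy] := leP y x; first by rewrite mulr1 mem_set//= in_itv /= yx.
  by rewrite mulr0 memNset//= in_itv /= leNgt xy.
by rewrite mul0r memNset// => /ysub /mem_set; exact/negP.
Qed.

Lemma integrable_mul_primitive : mu.-integrable `[a, b]
  (EFin \o (fun t => f t * \int[mu]_(y in `[a, t]) g y)).
Proof.
apply/integrable_mkcond => //; rewrite restrict_EFin.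
have := integrable_Rfubini_F ki; apply: eq_integrable => // x _.
by rewrite /= kF.
Qed.

Lemma primitive_mul_tail :
  \int[mu]_(t in `[a, b]) (f t * \int[mu]_(y in `[a, t]) g y) =
  \int[mu]_(t in `[a, b]) (g t * \int[mu]_(x in `[t, b]) f x).
Proof.
rewrite [LHS]Rintegral_mkcond [RHS]Rintegral_mkcond.
transitivity (\int[mu]_x \int[mu]_y k (x, y)).
  by apply: eq_Rintegral => x _; rewrite kF.
rewrite Rintegral_fubini//.
by apply: eq_Rintegral => y _; rewrite kG.
Qed.

End ProductRule.

Section PrimitiveMul.
Context {R : realType}.
Notation mu := (@lebesgue_measure R).

(** Integration by parts: [primitive_mul_tail] trades a head integral for a tail integral, and the
    tail is the total minus the head; the total produces the product. *)
Lemma primitive_mul (f g : R -> R) (a b : R) :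
  mu.-integrable `[a, b] (EFin \o f) -> mu.-integrable `[a, b] (EFin \o g) ->
  (\int[mu]_(t in `[a, b]) f t) * (\int[mu]_(t in `[a, b]) g t) =
  \int[mu]_(t in `[a, b]) (f t * \int[mu]_(y in `[a, t]) g y
                          + g t * \int[mu]_(y in `[a, t]) f y).
Proof.
move=> fi gi; have gFi := integrable_mul_primitive gi fi.
rewrite RintegralD//; last exact: integrable_mul_primitive.
rewrite primitive_mul_tail//.
have -> : \int[mu]_(t in `[a, b]) (g t * \int[mu]_(x in `[t, b]) f x) =
    \int[mu]_(t in `[a, b]) (g t * \int[mu]_(y in `[a, b]) f y
                            - g t * \int[mu]_(y in `[a, t]) f y).
  apply: eq_Rintegral => t; rewrite inE => tab.
  by rewrite (primitive_tail fi)// mulrBr.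
rewrite RintegralB//; last first.
  exact: (integrableZr _ _ gi).
by rewrite subrK RintegralZr// mulrC.
Qed.

End PrimitiveMul.

Section Primitives.
Context {R : realType}.
Notation mu := (@lebesgue_measure R).
Implicit Types (f g F G : R -> R) (a b : R).

Lemma integrableDR d (T : measurableType d) (m : {measure set T -> \bar R})
    (D : set T) (f g : T -> R) : measurable D ->
  m.-integrable D (EFin \o f) -> m.-integrable D (EFin \o g) ->
  m.-integrable D (EFin \o (fun x => f x + g x)).
Proof. by move=> mD fi gi; exact: (integrableD mD fi gi). Qed.

Lemma integrable_sumR d (T : measurableType d) (m : {measure set T -> \bar R})
    (D : set T) (I : Type) (r : seq I) (f : I -> T -> R) : measurable D ->
  (forall i, m.-integrable D (EFin \o f i)) ->
  m.-integrable D (EFin \o (fun x => \sum_(i <- r) f i x)).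
Proof.
move=> mD fi; have := integrable_sum mD r (P := xpredT) (fun i _ => fi i).
by apply: eq_integrable => // x _; rewrite /= sumEFin.
Qed.

Lemma Rintegral_sum d (T : measurableType d) (m : {measure set T -> \bar R})
    (D : set T) (I : Type) (r : seq I) (f : I -> T -> R) : measurable D ->
  (forall i, m.-integrable D (EFin \o f i)) ->
  \int[m]_(x in D) (\sum_(i <- r) f i x) = \sum_(i <- r) \int[m]_(x in D) f i x.
Proof.
move=> mD fi; elim: r => [|i r IH].
  by under eq_Rintegral do rewrite big_nil; rewrite Rintegral_cst// mul0r big_nil.
under eq_Rintegral do rewrite big_cons.
rewrite RintegralD//; first by rewrite IH big_cons.
exact: integrable_sumR.
Qed.

(** Absolute continuity in integrated form, with [f] in the role of the almost everywhere
    derivative. *)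
Definition primitive_on a b F f :=
  mu.-integrable `[a, b] (EFin \o f) /\
  forall t, t \in `[a, b] -> F t = F a + \int[mu]_(y in `[a, t]) f y.

Lemma integrable_head f a b t : t \in `[a, b] ->
  mu.-integrable `[a, b] (EFin \o f) -> mu.-integrable `[a, t] (EFin \o f).
Proof.
rewrite in_itv /= => /andP[at_ tb]; apply: integrableS => //.
by apply: subset_itv; rewrite bnd_simp.
Qed.

Lemma primitive_onS a b c F f : c \in `[a, b] ->
  primitive_on a b F f -> primitive_on c b F f.
Proof.
move=> cab [fi FE]; have := cab; rewrite in_itv /= => /andP[ac cb].
split=> [|t].
  by apply: integrableS fi => //; apply: subset_itv; rewrite bnd_simp.
rewrite in_itv /= => /andP[ct tb].
have tab : t \in `[a, b] by rewrite in_itv /= (le_trans ac ct).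
rewrite (FE t tab) (FE c cab) (@primitive_tail _ f a t c).
- by rewrite -addrA [X in _ = _ + X]addrC subrK.
- exact: integrable_head fi.
- by rewrite in_itv /= ac.
Qed.

Lemma integrable_mul_primitive_on a b F f g : primitive_on a b F f ->
  mu.-integrable `[a, b] (EFin \o g) ->
  mu.-integrable `[a, b] (EFin \o (fun t => g t * F t)).
Proof.
move=> [fi FE] gi.
have h : mu.-integrable `[a, b]
    (EFin \o (fun t => g t * F a + g t * \int[mu]_(y in `[a, t]) f y)).
  apply: integrableDR => //; first exact: (integrableZr _ _ gi).
  exact: integrable_mul_primitive.
apply: eq_integrable h => // t; rewrite inE => tab.
by rewrite /= -mulrDr -FE.
Qed.

Lemma integrable_cst_itv a b c : mu.-integrable `[a, b] (EFin \o cst c).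
Proof.
apply: measurable_bounded_integrable => //.
  by rewrite /= lebesgue_measure_itv /=; case: ifP; rewrite ?ltry// -EFinB ltry.
exact: bounded_cst.
Qed.

Lemma integrable_primitive_on a b F f : primitive_on a b F f ->
  mu.-integrable `[a, b] (EFin \o F).
Proof.
move=> Ff; have := integrable_mul_primitive_on Ff (integrable_cst_itv a b 1).
by apply: eq_integrable => // t _; rewrite /= mul1r.
Qed.

Lemma primitive_on_mul a b F f G g :
  primitive_on a b F f -> primitive_on a b G g ->
  primitive_on a b (fun t => F t * G t) (fun t => f t * G t + g t * F t).
Proof.
move=> Ff Gg; have [fi FE] := Ff; have [gi GE] := Gg.
have fG := integrable_mul_primitive_on Gg fi.
have gF := integrable_mul_primitive_on Ff gi.
split=> [|t tab].
  exact: integrableDR.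
have fit := integrable_head tab fi; have git := integrable_head tab gi.
(* Expansion around the initial values: the parts with [F a] and [G a] integrate directly, and the
   rest is [primitive_mul]. *)
have -> : \int[mu]_(y in `[a, t]) (f y * G y + g y * F y) =
    \int[mu]_(y in `[a, t]) ((f y * G a + g y * F a) +
      (f y * \int[mu]_(z in `[a, y]) g z + g y * \int[mu]_(z in `[a, y]) f z)).
  apply: eq_Rintegral => y; rewrite inE /= => yat.
  have yab : y \in `[a, b].
    move: yat tab; rewrite !in_itv /= => /andP[-> yt] /andP[_].
    exact: le_trans.
  by rewrite (FE y)// (GE y)//; ring.
rewrite RintegralD//; last 2 first.
- apply: integrableDR => //; first exact: (integrableZr _ _ fit).
  exact: (integrableZr _ _ git).
- by apply: integrableDR => //; exact: integrable_mul_primitive.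
rewrite -primitive_mul// RintegralD//; last 2 first.
- exact: (integrableZr _ _ fit).
- exact: (integrableZr _ _ git).
by rewrite !RintegralZr// (FE t)// (GE t)//; ring.
Qed.

Lemma primitive_on_scale a b F f c :
  primitive_on a b F f -> primitive_on a b (fun t => c * F t) (fun t => c * f t).
Proof.
move=> [fi FE]; split=> [|t tab]; first exact: (integrableZl _ c fi).
have fit := integrable_head tab fi.
by rewrite RintegralZl// (FE t tab) mulrDr.
Qed.

Lemma primitive_on_sum a b (I : Type) (r : seq I) (F f : I -> R -> R) :
  (forall i, primitive_on a b (F i) (f i)) ->
  primitive_on a b (fun t => \sum_(i <- r) F i t) (fun t => \sum_(i <- r) f i t).
Proof.
move=> Ff; split=> [|t tab].
  by apply: integrable_sumR => // i; exact: (Ff i).1.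
rewrite Rintegral_sum// => [|i]; last exact: integrable_head (Ff i).1.
by rewrite -big_split /=; apply: eq_bigr => i _; exact: (Ff i).2.
Qed.

Lemma primitive_on_expR a b c :
  primitive_on a b (fun t => expR (c * t)) (fun t => c * expR (c * t)).
Proof.
have dE (t : R) : is_derive t 1 (fun t => expR (c * t)) (c * expR (c * t)).
  have -> : c * expR (c * t) = expR (c * t) *: (c *: 1).
    by rewrite scaler1 [LHS]mulrC.
  exact: is_derive1_comp.
have cF : continuous (fun t : R => expR (c * t)).
  move=> t; apply: (@continuous_comp _ _ _ (fun t : R => c * t) expR).
    exact: mulrl_continuous.
  exact: continuous_expR.
have cf : continuous (fun t : R => c * expR (c * t)).
  by move=> t; exact: cvgM (cvg_cst _) (cF t).
split=> [|t].
  apply: continuous_compact_integrable; first exact: segment_compact.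
  exact: continuous_subspaceT.
rewrite in_itv /= le_eqVlt => /andP[/predU1P[<-|at_] _].
  by rewrite set_itv1 Rintegral_set1 addr0.
rewrite /Rintegral (@continuous_FTC2 _ _ (fun t => expR (c * t)) a t) //=.
- by rewrite [RHS]addrC subrK.
- exact: continuous_subspaceT.
- split=> [x _||]; first by case: (dE x).
    exact: cvg_at_right_filter (cF a).
  exact: cvg_at_left_filter (cF t).
- by move=> x _; rewrite derive1E; apply: derive_val.
Qed.

End Primitives.

(** * The data equation along an absolutely continuous trajectory *)

Section DataIdentity.
Context {R : realType} {n m : nat}.
Notation mu := (@lebesgue_measure R).
Variables (A : 'M[R]_n) (B : 'M[R]_(n, m)) (rho : R).
Variables (X : R -> 'cV[R]_n) (V : R -> 'cV[R]_m).

Let X' t : 'cV[R]_n := A *m X t + B *m V t.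
Let e t : R := expR (- rho * t).

Lemma integrable_mulmx k D (F : R -> 'rV[R]_k) (w : 'cV[R]_k) :
  measurable D ->
  (forall j, mu.-integrable D (EFin \o (fun t => F t 0 j))) ->
  mu.-integrable D (EFin \o (fun t => (F t *m w) 0 0)).
Proof.
move=> mD Fi; have := integrable_sumR (index_enum 'I_k) mD
  (fun j => integrableZr mD (w j 0) (Fi j)).
by apply: eq_integrable => // t _; rewrite /= mxE.
Qed.

Lemma mxint_mulmx k D (F : R -> 'rV[R]_k) (w : 'cV[R]_k) :
  measurable D ->
  (forall j, mu.-integrable D (EFin \o (fun t => F t 0 j))) ->
  (mxint D F *m w) 0 0 = \int[mu]_(t in D) ((F t *m w) 0 0).
Proof.
move=> mD Fi; rewrite mxE.
under eq_Rintegral do rewrite mxE.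
rewrite Rintegral_sum// => [|j]; last exact: (integrableZr _ _ (Fi j)).
by apply: eq_bigr => j _; rewrite mxE RintegralZr.
Qed.

Lemma quadv_entry k (x : 'cV[R]_n) :
  exists ij, forall x : 'cV[R]_n, quadv x k 0 = x ij.1 0 * x ij.2 0.
Proof.
case: n k x => [[]//|n' k x].
exists (nth (ord0, ord0) (upper_pairs n'.+1) k) => y.
by rewrite mxE (nth_map (ord0, ord0))// size_upper_pairs.
Qed.

Variables (a b : R).
Hypothesis Xp : forall i,
  primitive_on a b (fun t => X t i 0) (fun t => X' t i 0).
Hypothesis Vi : forall i, mu.-integrable `[a, b] (EFin \o (fun t => V t i 0)).

Let eXp i : primitive_on a b (fun t => e t * X t i 0)
  (fun t => - rho * e t * X t i 0 + X' t i 0 * e t).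
Proof. exact: primitive_on_mul (primitive_on_expR _ _ _) (Xp i). Qed.

(** The discount is attached to one factor: each term is [S i j] times the product of the primitives
    [e t * X t i 0] and [X t j 0]. *)
Lemma quadratic_primitive (S : 'M[R]_n) : S^T = S ->
  primitive_on a b (fun t => e t * bform S (X t) (X t))
    (fun t => e t * (2 * bform S (X' t) (X t) - rho * bform S (X t) (X t))).
Proof.
move=> Ssym.
have -> : (fun t => e t * bform S (X t) (X t)) = (fun t =>
    \sum_(i < n) \sum_(j < n) S i j * (e t * X t i 0 * X t j 0)).
  apply/funext => t; rewrite bformE mulr_sumr; apply: eq_bigr => i _.
  by rewrite mulr_sumr; apply: eq_bigr => j _; ring.
have -> : (fun t => e t * (2 * bform S (X' t) (X t)
      - rho * bform S (X t) (X t))) = (fun t =>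
    \sum_(i < n) \sum_(j < n) S i j * ((- rho * e t * X t i 0 + X' t i 0 * e t)
      * X t j 0 + X' t j 0 * (e t * X t i 0))).
  apply/funext => t; symmetry.
  transitivity (\sum_(i < n) \sum_(j < n) (e t * (X' t i 0 * S i j * X t j 0)
     + e t * (X t i 0 * S i j * X' t j 0) - (e t * rho) * (X t i 0 * S i j * X t j 0))).
    by apply: eq_bigr => i _; apply: eq_bigr => j _; ring.
  under eq_bigr do rewrite sumrB big_split /= -!mulr_sumr.
  rewrite sumrB big_split /= -!mulr_sumr -!bformE.
  by rewrite (bform_sym (X t) (X' t) Ssym); ring.
apply: primitive_on_sum => i; apply: primitive_on_sum => j.
by apply: primitive_on_scale; exact: primitive_on_mul.
Qed.

Lemma integrable_quadv k : mu.-integrable `[a, b]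
  (EFin \o (fun t => (e t *: (quadv (X t))^T) 0 k)).
Proof.
have [[i j] /= qE] := quadv_entry k 0.
have := integrable_primitive_on (primitive_on_mul (eXp i) (Xp j)).
apply: eq_integrable => // t _; rewrite /= mxE; congr EFin.
by rewrite [X in _ = e t * X]mxE qE mulrA.
Qed.

Lemma integrable_kronv k : mu.-integrable `[a, b]
  (EFin \o (fun t => (e t *: (kronv (X t) (V t))^T) 0 k)).
Proof.
pose ij := mxtens.mxtens_unindex k.
have := integrable_mul_primitive_on (eXp ij.1) (Vi ij.2).
apply: eq_integrable => // t _; rewrite /= !mxE !ord1; congr EFin.
by rewrite mulrC mulrA.
Qed.

(** One row of the data equation. With X' = A X + B V, the state contributes the form of S A + A^T S
    - rho S at X, and the control twice the bilinear form of B^T S at (V, X); these are the pairings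
    that [quadv_vecs] and [kronv_vec] compute. *)
Lemma quadratic_increment (S : 'M[R]_n) : a <= b -> S^T = S ->
  e b * bform S (X b) (X b) - e a * bform S (X a) (X a) =
  (mxint `[a, b] (fun t => e t *: (quadv (X t))^T)
     *m vecs (S *m A + A^T *m S - rho *: S)) 0 0
  + 2 * (mxint `[a, b] (fun t => e t *: (kronv (X t) (V t))^T)
     *m vec (B^T *m S)) 0 0.
Proof.
move=> ab Ssym.
have Msym : (S *m A + A^T *m S - rho *: S)^T = S *m A + A^T *m S - rho *: S.
  rewrite linearB linearD linearZ /= !trmx_mul trmxK Ssym.
  by rewrite [A^T *m _ + _]addrC.
have [_ /(_ b)] := quadratic_primitive Ssym.
rewrite bound_itvE ab => /(_ isT) ->; rewrite addrC addKr.
rewrite !mxint_mulmx//; [|exact: integrable_kronv|exact: integrable_quadv].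
have qi := integrable_mulmx (vecs (S *m A + A^T *m S - rho *: S))
  (measurable_itv _) integrable_quadv.
have ki := integrable_mulmx (vec (B^T *m S)) (measurable_itv _) integrable_kronv.
rewrite -RintegralZl// -RintegralD//; last exact: (integrableZl _ 2 ki).
apply: eq_Rintegral => t _.
have scale00 k c (u w : 'cV[R]_k) : (c *: u^T *m w) 0 0 = c * (u^T *m w) 0 0.
  by rewrite -scalemxAl mxE.
rewrite !scale00 quadv_vecs// kronv_vec bformBl bformDl bformZl.
rewrite bform_mulr bform_mull trmxK bform_mull trmxK.
rewrite (bform_sym _ (A *m X t) Ssym) /X' bformDm; ring.
Qed.

End DataIdentity.

(** * The mean of the state *)

Section NormalMoments.
Context {R : realType}.
Notation mu := (@lebesgue_measure R).

Lemma ge0_integral_opp (f : R -> \bar R) :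
  measurable_fun setT f -> (forall x, 0 <= f x)%E ->
  (\int[mu]_x f x = \int[mu]_x f (- x)%R)%E.
Proof.
move=> mf f0.
have mopp : measurable_fun setT (-%R : measurableTypeR R -> measurableTypeR R).
  exact: oppr_measurable.
transitivity (\int[pushforward mu (-%R : measurableTypeR R -> measurableTypeR R)]_x f x)%E.
  by apply: eq_measure_integral => A mA _; exact/esym/lebesgue_measureN.
by rewrite ge0_integral_pushforward.
Qed.

Variable s : R.
Hypothesis s0 : 0 < s.

(** The general change of variables involves a Radon-Nikodym derivative; it equals the density
    almost everywhere, since both have the same integral over every measurable set. *)
Lemma ge0_integral_normal_prob (f : R -> \bar R) :
  measurable_fun setT f -> (forall x, 0 <= f x)%E ->
  (\int[normal_prob 0 s]_x f x = \int[mu]_x (f x * (normal_pdf 0 s x)%:E))%E.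
Proof.
move=> mf f0; have dom := normal_prob_dominates 0 s.
rewrite -(Radon_Nikodym_SigmaFinite.change_of_variables dom f0 measurableT mf).
have mpdf : measurable_fun setT (EFin \o normal_pdf 0 s).
  by apply/measurable_EFinP; exact: measurable_normal_pdf.
have mrn := measurable_int _ (Radon_Nikodym_SigmaFinite.f_integrable dom).
apply: ae_eq_integral => //.
- exact: emeasurable_funM.
- exact: emeasurable_funM.
apply: ae_eqe_mul2l; apply: integral_ae_eq => //.
  exact: Radon_Nikodym_SigmaFinite.f_integrable dom.
by move=> E _ mE; rewrite -(Radon_Nikodym_SigmaFinite.f_integral dom).
Qed.

Lemma normal_pdf_even x : normal_pdf 0 s (- x) = normal_pdf 0 s x :> R.
Proof.
by rewrite normal_pdfE ?gt_eqF//= /normal_fun !subr0 sqrrN.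
Qed.

(* [|x| / s <= 1 + (x / s)^2 / 4 <= exp (x^2 / (4 s^2))]: the first absolute
   moment is absorbed by a normal density with twice the variance. *)
Lemma normal_pdf_moment_le x :
  `|x| * normal_pdf 0 s x <= Num.sqrt 2 * s * normal_pdf 0 (Num.sqrt 2 * s) x.
Proof.
have s2 : 0 < Num.sqrt 2 * s by rewrite mulr_gt0// sqrtr_gt0.
rewrite !normal_pdfE ?gt_eqF//= /normal_peak /normal_fun !subr0.
rewrite exprMn sqr_sqrtr//.
have -> : Num.sqrt (2 * s ^+ 2 * pi *+ 2) = Num.sqrt 2 * Num.sqrt (s ^+ 2 * pi *+ 2).
  by rewrite -mulrA -mulrnAr sqrtrM.
set N := Num.sqrt (s ^+ 2 * pi *+ 2).
have N0 : 0 < N.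
  by rewrite sqrtr_gt0 pmulrn_lgt0// mulr_gt0 ?pi_gt0// exprn_gt0.
have sq2 : 0 < Num.sqrt 2 :> R by rewrite sqrtr_gt0.
set E1 := expR _; set E2 := expR _.
have -> : `|x| * (N^-1 * E1) = `|x| * E1 / N by ring.
have -> : Num.sqrt 2 * s * ((Num.sqrt 2 * N)^-1 * E2) = s * E2 / N.
  by field; rewrite !gt_eqF.
rewrite /E1 /E2 {E1 E2}.
rewrite ler_pM2r ?invr_gt0//.
have -> : - x ^+ 2 / (s ^+ 2 *+ 2) =
    - x ^+ 2 / (2 * s ^+ 2 *+ 2) + - x ^+ 2 / (2 * s ^+ 2 *+ 2).
  by field; rewrite gt_eqF.
rewrite expRD mulrA ler_pM2r ?expR_gt0//.
rewrite mulNr expRN ler_pdivrMr ?expR_gt0// -ler_pdivrMl//.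
apply: le_trans (expR_ge1Dx _).
rewrite (_ : x ^+ 2 / (2 * s ^+ 2 *+ 2) = (s^-1 * `|x|) ^+ 2 / 4).
  by have := sqr_ge0 (s^-1 * `|x| - 2); lra.
by rewrite exprMn real_normK ?num_real//; field; rewrite gt_eqF.
Qed.

Context d (Omega : measurableType d) (Pr : probability Omega R).
Variable xi : Omega -> R.
Hypothesis mxi : measurable_fun setT xi.
Hypothesis xiN : forall E, measurable E -> Pr (xi @^-1` E) = normal_prob 0 s E.

Lemma ge0_expectation_normal (f : R -> \bar R) :
  measurable_fun setT f -> (forall x, 0 <= f x)%E ->
  (\int[Pr]_w f (xi w) = \int[mu]_x (f x * (normal_pdf 0 s x)%:E))%E.
Proof.
move=> mf f0; rewrite -ge0_integral_normal_prob//.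
have mxi' : measurable_fun setT (xi : Omega -> measurableTypeR R) := mxi.
pose X : {mfun Omega >-> measurableTypeR R} :=
  @mfun_Sub _ _ Omega (measurableTypeR R) xi (mem_set mxi').
rewrite -[LHS](ge0_integral_distribution X)//.
by apply: eq_measure_integral => A mA _; exact: xiN.
Qed.

Lemma normal_abs_moment_le :
  (\int[Pr]_w `|xi w|%:E <= (Num.sqrt 2 * s)%:E)%E.
Proof.
rewrite (ge0_expectation_normal (f := fun x => `|x|%:E))//; last first.
  by apply/measurable_EFinP; exact: normr_measurable.
apply: (@le_trans _ _ (\int[mu]_x
    ((Num.sqrt 2 * s)%:E * (normal_pdf 0 (Num.sqrt 2 * s) x)%:E))%E).
  apply: ge0_le_integral => //.
  - by move=> x _; rewrite -EFinM lee_fin mulr_ge0// normal_pdf_ge0.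
  - apply/measurable_EFinP; apply: measurable_funM.
      exact: normr_measurable.
    exact: measurable_normal_pdf.
  - apply/measurable_EFinP; apply: measurable_funM => //.
    exact: measurable_normal_pdf.
  - by move=> x _; rewrite -!EFinM lee_fin normal_pdf_moment_le.
rewrite integralZl//; last exact: integrable_normal_pdf.
by rewrite integral_normal_pdf mule1.
Qed.

(** The density is even, so the positive and negative parts have the same integral. The absolute
    moment bound makes it finite, so that the difference is a genuine 0. *)
Lemma normal_mean0 : (\int[Pr]_w (xi w)%:E = 0)%E.
Proof.
rewrite integralE.
have h (f : R -> R) : measurable_fun setT f -> (forall x, 0 <= f x) ->
    (\int[Pr]_w (f (xi w))%:E = \int[Pr]_w (f (- xi w))%:E)%E.
  move=> mf f0.
  have mfo : measurable_fun setT (fun x : R => f (- x)).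
    by apply: (measurableT_comp mf); exact: oppr_measurable.
  rewrite (ge0_expectation_normal (f := EFin \o f))//; last first.
    exact/measurable_EFinP.
  rewrite (ge0_expectation_normal (f := fun x => (f (- x))%:E));
    [|exact/measurable_EFinP|by move=> x; rewrite lee_fin].
  transitivity (\int[mu]_x ((f (- x))%:E * (normal_pdf 0 s (- x))%:E))%E.
    apply: (ge0_integral_opp (f := fun x => (f x)%:E * (normal_pdf 0 s x)%:E)%E).
      apply: emeasurable_funM; apply/measurable_EFinP => //.
      exact: measurable_normal_pdf.
    by move=> x; rewrite mule_ge0// lee_fin// normal_pdf_ge0.
  by apply: eq_integral => x _; rewrite normal_pdf_even.
have mp : measurable_fun setT (fun x : R => Num.max x 0).
  by apply: measurable_maxr.
have -> : (\int[Pr]_w (fun w => (xi w)%:E)^\+ w =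
    \int[Pr]_w (Num.max (xi w) 0)%:E)%E.
  by apply: eq_integral => w _; rewrite funeposE -EFin_max.
have -> : (\int[Pr]_w (fun w => (xi w)%:E)^\- w =
    \int[Pr]_w (Num.max (- xi w) 0)%:E)%E.
  by apply: eq_integral => w _; rewrite funenegE -EFinN -EFin_max.
rewrite (h (fun x => Num.max x 0))//; last by move=> x; rewrite le_max lexx orbT.
rewrite subee// ge0_fin_numE; last first.
  by apply: integral_ge0 => w _; rewrite lee_fin le_max lexx orbT.
apply: le_lt_trans (ltry (Num.sqrt 2 * s)); apply: le_trans normal_abs_moment_le.
apply: ge0_le_integral => //.
- by move=> w _; rewrite lee_fin le_max lexx orbT.
- by apply/measurable_EFinP; apply: (measurableT_comp mp); exact: measurableT_comp.
- by apply/measurable_EFinP; exact: measurableT_comp.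
- by move=> w _; rewrite lee_fin ge_max normr_ge0 andbT -normrN ler_norm.
Qed.

End NormalMoments.

(** * Integrable processes: Fubini in time and probability *)

Section ProcessFubini.
Context {R : realType} {d : measure_display} {Omega : measurableType d}.
Variable Pr : probability Omega R.
Notation mu := (@lebesgue_measure R).
Implicit Types (y h : R -> Omega -> R) (T t : R).

(** Processes are measurable only on times [t >= 0]; extension by 0 outside [[0, T]] gives a
    function on the whole product space, where Fubini applies. *)
Definition cut T y (z : measurableTypeR R * Omega) : R :=
  ((y ^~ z.2) \_ `[0, T]) z.1.

Definition process y := measurable_fun
  (times `*` [set: Omega] : set (measurableTypeR R * Omega))
  (fun z => y z.1 z.2).

Definition process_L1 T y :=
  process y /\ (mu \x Pr)%E.-integrable setT (EFin \o cut T y).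

Lemma measurable_cut T y : process y -> measurable_fun setT (cut T y).
Proof.
move=> my.
have mT : measurable
    (`[0%R, T]%classic `*` [set: Omega] : set (measurableTypeR R * Omega)).
  by apply: measurableX.
have -> : cut T y =
    (fun z : measurableTypeR R * Omega => y z.1 z.2) \_ (`[0, T] `*` setT).
  apply/funext => -[t w]; rewrite /cut !patchE /=.
  by congr (if _ then _ else _); apply/idP/idP; rewrite !inE /= => // -[].
apply/(measurable_restrictT _ mT).
apply: measurable_funS my => //.
  by apply: measurableX => //; exact: measurable_itv.
by move=> [t w] [/=]; rewrite /times /= !in_itv /= andbT => /andP[].
Qed.

Lemma process_section_time y w : process y ->
  measurable_fun (times : set (measurableTypeR R)) (y ^~ w).
Proof.
move=> my; apply: (measurable_comp (F := times `*` setT) (f := fun z => y z.1 z.2)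
    (g := fun t : measurableTypeR R => (t, w))) => //.
- by apply: measurableX => //; exact: measurable_itv.
- by move=> _ [t tt <-].
- by apply: measurable_funTS; exact: measurable_pair2.
Qed.

Lemma process_section_omega y t : process y -> 0 <= t -> measurable_fun setT (y t).
Proof.
move=> my t0; apply: (measurable_comp (F := times `*` setT) (f := fun z => y z.1 z.2)
    (g := fun w : Omega => (t : measurableTypeR R, w))) => //.
- by apply: measurableX => //; exact: measurable_itv.
- by move=> _ [w _ <-]; split=> //=; rewrite /times /= in_itv /= t0.
- exact: measurable_pair1.
Qed.

(** Tonelli in one order, [process_L1_of_mean] being the other: control and state are estimated
    along paths, the Brownian motion at fixed times. *)
Lemma process_L1_of_path T y : process y ->
  (\int[Pr]_w \int[mu]_(t in `[0%R, T]) `|y t w|%:E < +oo)%E -> process_L1 T y.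
Proof.
move=> my yoo; split=> //; apply/(integrable21ltyP mu Pr).
  by apply/measurable_EFinP; exact: measurable_cut.
rewrite (eq_integral (fun w => \int[mu]_(t in `[0%R, T]) `|y t w|%:E))%E// => w _.
rewrite [RHS]integral_mkcond; apply: eq_integral => t _.
by rewrite /= /cut !patchE /=; case: ifP => //; rewrite normr0.
Qed.

Lemma process_L1_of_mean T y : process y ->
  (\int[mu]_(t in `[0%R, T]) \int[Pr]_w `|y t w|%:E < +oo)%E -> process_L1 T y.
Proof.
move=> my yoo; split=> //; apply/(integrable12ltyP mu Pr).
  by apply/measurable_EFinP; exact: measurable_cut.
apply: le_lt_trans yoo; rewrite [leRHS]integral_mkcond le_eqVlt.
apply/orP; left; apply/eqP; apply: eq_integral => t _.
rewrite [RHS]patchE /cut; case: ifPn => tT.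
  by apply: eq_integral => w _; rewrite /= patchE tT.
by apply: integral0_eq => w _; rewrite /= patchE (negbTE tT) normr0.
Qed.

Lemma process_L1_le T y h : process y ->
  (forall t w, t \in `[0, T] -> `|y t w| <= `|h t w|) ->
  process_L1 T h -> process_L1 T y.
Proof.
move=> my yh [mh hi]; split=> //; apply: le_integrable hi => //.
  by apply/measurable_EFinP; exact: measurable_cut.
move=> [t w] _; rewrite /= /cut !patchE /= lee_fin; case: ifPn => //.
by rewrite inE => /yh.
Qed.

Lemma process_cst (f : Omega -> R) : measurable_fun setT f -> process (fun _ => f).
Proof.
move=> mf; apply: measurable_funTS.
exact: (measurableT_comp mf measurable_snd).
Qed.

Lemma process_L1_cst T (f : Omega -> R) :
  Pr.-integrable setT (EFin \o f) -> process_L1 T (fun _ => f).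
Proof.
move=> fi; split.
  by apply: process_cst; exact/measurable_EFinP/(measurable_int Pr).
have mT : measurable (`[0%R, T]%classic : set (measurableTypeR R)) by [].
have := integrable_tensor (integrable_patch mT (integrable_cst_itv 0 T 1)) fi.
apply: eq_integrable => // -[t w] _; rewrite /= /cut !patchE /=.
by case: ifP; rewrite ?mul1r ?mul0r.
Qed.

Lemma processD y h : process y -> process h -> process (fun t w => y t w + h t w).
Proof. exact: measurable_funD. Qed.

Lemma processZ c y : process y -> process (fun t w => c * y t w).
Proof. by move=> my; apply: measurable_funM => //; exact: measurable_cst. Qed.

Lemma process_sum (I : Type) (r : seq I) (y : I -> R -> Omega -> R) :
  (forall i, process (y i)) -> process (fun t w => \sum_(i <- r) y i t w).
Proof. by move=> my; apply: measurable_sum. Qed.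

Lemma process_norm y : process y -> process (fun t w => `|y t w|).
Proof. by move=> my; exact: measurableT_comp. Qed.

Lemma process_L1D T y h : process_L1 T y -> process_L1 T h ->
  process_L1 T (fun t w => y t w + h t w).
Proof.
move=> [my yi] [mh hi]; split; first exact: processD.
have := integrableDR measurableT yi hi.
apply: eq_integrable => // -[t w] _; rewrite /= /cut !patchE /=.
by case: ifP; rewrite ?addr0.
Qed.

Lemma process_L1Z T c y : process_L1 T y -> process_L1 T (fun t w => c * y t w).
Proof.
move=> [my yi]; split; first exact: processZ.
have := integrableZl measurableT c yi.
apply: eq_integrable => // -[t w] _; rewrite /= /cut !patchE /=.
by case: ifP; rewrite ?mule0.
Qed.

Lemma process_L1_sum T (I : Type) (r : seq I) (y : I -> R -> Omega -> R) :
  (forall i, process_L1 T (y i)) ->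
  process_L1 T (fun t w => \sum_(i <- r) y i t w).
Proof.
move=> yi; split; first by apply: process_sum => i; exact: (yi i).1.
have := integrable_sumR r measurableT (fun i => (yi i).2).
apply: eq_integrable => // -[t w] _; rewrite /= /cut patchE /=; case: ifPn => tT.
  by congr EFin; apply: eq_bigr => i _; rewrite patchE tT.
by rewrite big1// => i _; rewrite patchE (negbTE tT).
Qed.

Lemma process_L1_norm T y : process_L1 T y -> process_L1 T (fun t w => `|y t w|).
Proof.
move=> yi; apply: (process_L1_le _ _ yi); first exact: process_norm yi.1.
by move=> t w _; rewrite normr_id.
Qed.

Section L1.
Variables (T : R) (y : R -> Omega -> R).
Hypothesis yi : process_L1 T y.

Lemma process_L1_path :
  {ae Pr, forall w, mu.-integrable `[0, T] (EFin \o (y ^~ w))}.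
Proof.
have := ae_integrable2 yi.2; apply: filterS => w wi.
apply/integrable_mkcond; first exact: measurable_itv.
by rewrite restrict_EFin; exact: wi.
Qed.

Lemma process_L1_state :
  {ae mu, forall t, t \in `[0, T] -> Pr.-integrable setT (EFin \o y t)}.
Proof.
have := ae_integrable1 yi.2; apply: filterS => t ti tT.
apply: eq_integrable ti => // w _; rewrite /= /cut patchE /= mem_set//.
Qed.

Lemma process_mean_integrable :
  mu.-integrable `[0, T] (EFin \o (fun t => \int[Pr]_w y t w)).
Proof.
apply/integrable_mkcond; first exact: measurable_itv.
have := integrable_Rfubini_F yi.2; apply: eq_integrable => // t _.
rewrite /= patchE /cut; case: ifPn => tT /=; congr EFin.
  by apply: eq_Rintegral => w _; rewrite patchE tT.
by under eq_Rintegral do rewrite patchE (negbTE tT); rewrite Rintegral_cst ?mul0r.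
Qed.

Lemma process_path_integral_integrable :
  Pr.-integrable setT (EFin \o (fun w => \int[mu]_(t in `[0, T]) y t w)).
Proof.
have := integrable_Rfubini_G yi.2; apply: eq_integrable => // w _.
by rewrite /= [in RHS]Rintegral_mkcond.
Qed.

Lemma process_fubini : \int[Pr]_w (\int[mu]_(t in `[0, T]) y t w) =
  \int[mu]_(t in `[0, T]) (\int[Pr]_w y t w).
Proof.
transitivity (\int[Pr]_w \int[mu]_t cut T y (t, w)).
  by apply: eq_Rintegral => w _; rewrite Rintegral_mkcond.
rewrite -Rintegral_fubini; last exact: yi.2.
rewrite [RHS]Rintegral_mkcond; apply: eq_Rintegral => t _.
rewrite patchE /cut; case: ifPn => tT.
  by apply: eq_Rintegral => w _; rewrite patchE tT.
by under eq_Rintegral do rewrite patchE (negbTE tT); rewrite Rintegral_cst ?mul0r.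
Qed.

End L1.

End ProcessFubini.

(** * Gronwall's inequality and the sum norm *)

Section Gronwall.
Context {R : realType}.
Notation mu := (@lebesgue_measure R).

(** [expR (- L * t) * Phi t] is a primitive of [expR (- L * t) * (g t - L * Phi t)], which is at
    most [a t]. The conclusion concerns integrals because it serves to bound the state in L1 over
    time and probability. *)
Lemma gronwall_L1 (T L : R) (g a : R -> R) : 0 <= T -> 0 <= L ->
  mu.-integrable `[0, T] (EFin \o g) -> mu.-integrable `[0, T] (EFin \o a) ->
  (forall t, t \in `[0, T] -> 0 <= a t) ->
  (forall t, t \in `[0, T] -> g t <= a t + L * \int[mu]_(s in `[0, t]) g s) ->
  \int[mu]_(t in `[0, T]) g t <= expR (L * T) * \int[mu]_(t in `[0, T]) a t.
Proof.
move=> T0 L0 gi ai a0 gle; pose Phi t := \int[mu]_(s in `[0, t]) g s.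
have Phi0 : Phi 0 = 0 by rewrite /Phi set_itv1 Rintegral_set1.
have PhiP : primitive_on 0 T Phi g by split=> // t _; rewrite Phi0 add0r.
have := primitive_on_mul (primitive_on_expR 0 T (- L)) PhiP.
have TT : T \in `[0, T] by rewrite bound_itvE.
move=> [di /(_ T TT)]; rewrite Phi0 mulr0 add0r => PhiT.
have : expR (- L * T) * Phi T <= \int[mu]_(t in `[0, T]) a t.
  rewrite PhiT; apply: le_Rintegral => // t; rewrite /= => tT.
  have h : expR (- L * t) * (g t - L * Phi t) <= expR (- L * t) * a t.
    by rewrite ler_wpM2l ?expR_ge0// lerBlDr; exact: gle.
  have t0 : 0 <= t by move: tT; rewrite in_itv /= => /andP[].
  have h1 : expR (- L * t) * a t <= a t.
    by rewrite ler_piMl ?a0// expR_le1 mulNr oppr_le0 mulr_ge0.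
  apply: le_trans h1; apply: le_trans h; rewrite le_eqVlt; apply/orP; left.
  by apply/eqP; ring.
by rewrite mulNr expRN mulrC ler_pdivrMr ?expR_gt0// mulrC.
Qed.

(** The sum norm passes through integrals with constant 1, see [norm1_mxint]. *)
Definition norm1 k (v : 'cV[R]_k) : R := \sum_i `|v i 0|.

Lemma norm1_ge0 k (v : 'cV[R]_k) : 0 <= norm1 v.
Proof. exact: sumr_ge0. Qed.

Lemma norm1_entry k (v : 'cV[R]_k) i : `|v i 0| <= norm1 v.
Proof. by rewrite /norm1 (bigD1 i)//= lerDl sumr_ge0. Qed.

Lemma norm1D k (v w : 'cV[R]_k) : norm1 (v + w) <= norm1 v + norm1 w.
Proof.
by rewrite /norm1 -big_split /=; apply: ler_sum => i _; rewrite mxE ler_normD.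
Qed.

Lemma norm1_mulmx k l (M : 'M[R]_(k, l)) : exists2 c, 0 <= c &
  forall v, norm1 (M *m v) <= c * norm1 v.
Proof.
exists (\sum_i \sum_j `|M i j|) => [|v]; first by do 2! apply: sumr_ge0 => ? _.
rewrite mulr_suml; apply: ler_sum => i _; rewrite mxE mulr_suml.
rewrite (le_trans (ler_norm_sum _ _ _))//; apply: ler_sum => j _.
by rewrite normrM ler_wpM2l// norm1_entry.
Qed.

Lemma norm1_mxint k (D : set (measurableTypeR R)) (F : R -> 'cV[R]_k) : measurable D ->
  (forall i, mu.-integrable D (EFin \o (fun t => F t i 0))) ->
  norm1 (mxint D F) <= \int[mu]_(t in D) norm1 (F t).
Proof.
move=> mD Fi; rewrite /norm1 Rintegral_sum//; last first.
  by move=> i; exact: integrable_norm (Fi i).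
by apply: ler_sum => i _; rewrite mxE le_normr_Rintegral.
Qed.

Lemma integrable_norm1 k (D : set (measurableTypeR R)) (F : R -> 'cV[R]_k) :
  measurable D ->
  (forall i, mu.-integrable D (EFin \o (fun t => F t i 0))) ->
  mu.-integrable D (EFin \o (fun t => norm1 (F t))).
Proof.
by move=> mD Fi; apply: integrable_sumR => // i; exact: integrable_norm (Fi i).
Qed.

Lemma integrable_mulmx_entry k l (M : 'M[R]_(k, l))
    (D : set (measurableTypeR R)) (F : R -> 'cV[R]_l) :
  measurable D ->
  (forall i, mu.-integrable D (EFin \o (fun t => F t i 0))) ->
  forall i, mu.-integrable D (EFin \o (fun t => (M *m F t) i 0)).
Proof.
move=> mD Fi i; have := integrable_sumR (index_enum 'I_l) mD
  (fun j => integrableZl mD (M i j) (Fi j)).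
by apply: eq_integrable => // t _; rewrite /= mxE.
Qed.

End Gronwall.

(** * The integral equation of the mean *)

Section MeanDynamics.
Context {R : realType} {n m p : nat}.
Notation mu := (@lebesgue_measure R).
Variables (A : 'M[R]_n) (B : 'M[R]_(n, m)) (C : 'M[R]_(n, p)) (rho : R).
Hypothesis rho0 : 0 < rho.
Context (d : measure_display) (Omega : measurableType d).
Variables (Pr : probability Omega R).
Variables (W : R -> Omega -> 'cV[R]_p) (x0 : Omega -> 'cV[R]_n).
Variables (u : R -> Omega -> 'cV[R]_m) (x : R -> Omega -> 'cV[R]_n).
Hypotheses (hW : brownian_motion Pr W) (hx0 : initial_state Pr W x0).
Hypotheses (hu : admissible Pr rho W u) (hx : solves_sde Pr A B C W x0 u x).

Lemma measurable_path_integral (D : set R) (y : R -> Omega -> R) :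
  measurable (D : set (measurableTypeR R)) -> D `<=` times -> process y ->
  (forall t w, 0 <= y t w) ->
  measurable_fun setT (fun w => \int[mu]_(t in D) (y t w)%:E)%E.
Proof.
move=> mD Dt my y0.
have mDO : measurable (D `*` [set: Omega] : set (measurableTypeR R * Omega)).
  exact: measurableX.
pose f (z : measurableTypeR R * Omega) : \bar R :=
  (((fun z => y z.1 z.2) \_ (D `*` setT)) z)%:E.
have -> : (fun w => \int[mu]_(t in D) (y t w)%:E)%E = fubini_G mu f.
  apply/funext => w; rewrite integral_mkcond; apply: eq_integral => t _.
  rewrite /f !patchE; have [tD|tD] := pselect (D t).
    by rewrite !mem_set.
  by rewrite !memNset// => -[].
apply: measurable_fun_fubini_tonelli_G; last first.
  by move=> z; rewrite lee_fin patchE; case: ifP.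
apply/measurable_EFinP; apply/(measurable_restrictT _ mDO).
apply: measurable_funS my.
  by apply: measurableX => //; exact: measurable_itv.
by move=> [t w] [/= /Dt].
Qed.

Lemma measurable_state_integral (D : set R) (y : R -> Omega -> R) :
  measurable (D : set (measurableTypeR R)) -> D `<=` times -> process y ->
  (forall t w, 0 <= y t w) ->
  measurable_fun D (fun t => \int[Pr]_w (y t w)%:E)%E.
Proof.
move=> mD Dt my y0.
have mDO : measurable (D `*` [set: Omega] : set (measurableTypeR R * Omega)).
  exact: measurableX.
pose f (z : measurableTypeR R * Omega) : \bar R :=
  (((fun z => y z.1 z.2) \_ (D `*` setT)) z)%:E.
apply: (eq_measurable_fun (fubini_F Pr f)).
  move=> t; rewrite inE => tD; apply: eq_integral => w _.
  by rewrite /f patchE mem_set.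
apply: measurable_funTS; apply: measurable_fun_fubini_tonelli_F; last first.
  by move=> z; rewrite lee_fin patchE; case: ifP.
apply/measurable_EFinP; apply/(measurable_restrictT _ mDO).
apply: measurable_funS my.
  by apply: measurableX => //; exact: measurable_itv.
by move=> [t w] [/= /Dt].
Qed.

Let pu i : process (fun t w => u t w i 0) := adm_meas hu i.
Let px i : process (fun t w => x t w i 0) := sde_meas hx i.
Let pW i : process (fun t w => W t w i 0) := bm_meas hW i.

Let itv_times T : `[0, T]%classic `<=` @times R.
Proof. by move=> t /=; rewrite /times /= !in_itv /= andbT => /andP[]. Qed.

Let mitv (T : R) : measurable (`[0, T]%classic : set (measurableTypeR R)).
Proof. exact: measurable_itv. Qed.

(** On [[0, T]] the discount factor is at least exp(- rho T), and a number is at most 1 plus its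
    square. *)
Lemma control_L1 T i : process_L1 Pr T (fun t w => u t w i 0).
Proof.
pose q t w : R := expR (- rho * t) * sqnorm (u t w).
have q0 t w : 0 <= q t w by rewrite mulr_ge0 ?expR_ge0 ?sqnorm_ge0.
have pq : process q.
  apply: measurable_funM.
    apply: measurable_funTS; apply: measurableT_comp => //=.
    by apply: measurable_funM => //; exact: measurable_fst.
  by apply: measurable_sum => j; apply: measurable_funX; exact: pu.
have qL : process_L1 Pr T q.
  apply: process_L1_of_path => //; apply: le_lt_trans (adm_moment2 hu).
  apply: ge0_le_integral => //.
  - by move=> w _; apply: integral_ge0 => t _; rewrite lee_fin.
  - by apply: measurable_path_integral => //; exact: process_norm.
  - by apply: measurable_path_integral => //; exact: measurable_itv.
  move=> w _; under eq_integral do rewrite ger0_norm//.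
  apply: ge0_subset_integral => //.
  - exact: measurable_itv.
  - apply/measurable_EFinP; exact: process_section_time w pq.
  - by move=> t _; rewrite lee_fin.
apply: (@process_L1_le _ _ _ _ _ _ (fun t w => 1 + expR (rho * T) * q t w)) => //.
- move=> t w; rewrite in_itv /= => /andP[t0 tT].
  have qu : sqnorm (u t w) <= expR (rho * T) * q t w.
    rewrite /q mulrA -expRD ler_peMl ?sqnorm_ge0// -[leLHS]expR0 ler_expR.
    by rewrite mulNr -mulrBr mulr_ge0 ?(ltW rho0)// subr_ge0.
  have ui : u t w i 0 ^+ 2 <= sqnorm (u t w).
    by rewrite /sqnorm (bigD1 i)//= lerDl sumr_ge0// => *; exact: sqr_ge0.
  rewrite [leRHS]ger0_norm; last exact: addr_ge0 ler01 (mulr_ge0 (expR_ge0 _) (q0 t w)).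
  have : `|u t w i 0| <= 1 + u t w i 0 ^+ 2.
    rewrite -[X in 1 + X](real_normK (num_real _)).
    by have := sqr_ge0 (`|u t w i 0| - 2^-1); lra.
  by lra.
- apply: process_L1D; last exact: process_L1Z.
  apply: process_L1_cst; have := finite_measure_integrable_cst Pr 1 measurableT.
  exact.
Qed.

(** The law of [W t - W 0] is given and [W 0 = 0] almost surely; time 0 is treated apart because
    [bm_gauss] concerns [s < t]. *)
Lemma brownian_moment t l : 0 <= t ->
  (\int[Pr]_w `|W t w l 0|%:E <= (Num.sqrt 2 * Num.sqrt t)%:E)%E /\
  (\int[Pr]_w (W t w l 0)%:E = 0)%E.
Proof.
move=> t0; have mWt r : 0 <= r -> measurable_fun setT (fun w => W r w l 0).
  by move=> r0; exact: process_section_omega (pW l) r0.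
pose xi w := (W t w - W 0 w) l 0.
have mxi : measurable_fun setT xi.
  rewrite /xi; under eq_fun do rewrite !mxE.
  by apply: measurable_funB; exact: mWt.
have W0 : {ae Pr, forall w, W t w l 0 = xi w}.
  by apply: filterS (bm_start hW) => w w0; rewrite /xi w0 subr0.
have -> : (\int[Pr]_w `|W t w l 0|%:E = \int[Pr]_w `|xi w|%:E)%E.
  apply: ae_eq_integral => //.
  - by apply/measurable_EFinP; apply: measurableT_comp => //; exact: mWt.
  - by apply/measurable_EFinP; apply: measurableT_comp.
  - by apply: filterS W0 => w -> _.
have -> : (\int[Pr]_w (W t w l 0)%:E = \int[Pr]_w (xi w)%:E)%E.
  apply: ae_eq_integral => //.
  - by apply/measurable_EFinP; exact: mWt.
  - by apply/measurable_EFinP.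
  - by apply: filterS W0 => w -> _.
move: t0; rewrite le_eqVlt => /predU1P[t0|t0].
  have xi0 w : xi w = 0 by rewrite /xi -t0 subrr mxE.
  under eq_integral do rewrite xi0 normr0.
  under [X in _ /\ X = _]eq_integral do rewrite xi0.
  by rewrite integral0 lee_fin mulr_ge0.
have xiN E : measurable E -> Pr (xi @^-1` E) = normal_prob 0 (Num.sqrt t) E.
  by move=> mE; have := bm_gauss hW l (lexx 0) t0 mE; rewrite subr0.
have st0 : 0 < Num.sqrt t by rewrite sqrtr_gt0.
split; first exact: normal_abs_moment_le xiN.
exact: normal_mean0 xiN.
Qed.

Lemma brownian_L1 T l : process_L1 Pr T (fun t w => W t w l 0).
Proof.
apply: process_L1_of_mean; first exact: pW.
apply: (@le_lt_trans _ _ (\int[mu]_(t in `[0%R, T]) (Num.sqrt 2 * Num.sqrt T)%:E)%E).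
  apply: ge0_le_integral => //.
  - by move=> t _; apply: integral_ge0.
  - by apply: measurable_state_integral => //; exact: process_norm.
  - move=> t /=; rewrite in_itv /= => /andP[t0 tT].
    apply: le_trans (brownian_moment l t0).1 _.
    by rewrite lee_fin ler_wpM2l// ler_wsqrtr.
have /integrable_lty := integrable_cst_itv 0 T (Num.sqrt 2 * Num.sqrt T).
by apply; exact: mitv.
Qed.

Lemma initial_integrable i : Pr.-integrable setT (EFin \o (fun w => x0 w i 0)).
Proof.
have m0 j : measurable_fun setT (fun w => x0 w j 0) := init_meas hx0 j.
have ms : measurable_fun setT (fun w => sqnorm (x0 w)).
  by apply: measurable_sum => j; apply: measurable_funX.
have si : Pr.-integrable setT (EFin \o (fun w => 1 + sqnorm (x0 w))).
  apply: integrableDR => //.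
    by have := finite_measure_integrable_cst Pr 1 measurableT; exact.
  apply/integrableP; split; first exact/measurable_EFinP.
  under eq_integral do rewrite /= ger0_norm ?sqnorm_ge0//.
  by have := init_moment2 hx0; rewrite unlock.
apply: le_integrable si => //; first exact/measurable_EFinP.
move=> w _; rewrite /= lee_fin [leRHS]ger0_norm ?addr_ge0 ?sqnorm_ge0//.
have ui : x0 w i 0 ^+ 2 <= sqnorm (x0 w).
  by rewrite /sqnorm (bigD1 i)//= lerDl sumr_ge0// => *; exact: sqr_ge0.
have : `|x0 w i 0| <= 1 + x0 w i 0 ^+ 2.
  rewrite -[X in 1 + X](real_normK (num_real _)).
  by have := sqr_ge0 (`|x0 w i 0| - 2^-1); lra.
by lra.
Qed.

Lemma process_L1_norm1 k T (y : R -> Omega -> 'cV[R]_k) :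
  (forall i, process_L1 Pr T (fun t w => y t w i 0)) ->
  process_L1 Pr T (fun t w => norm1 (y t w)).
Proof. by move=> yi; apply: process_L1_sum => i; exact: process_L1_norm. Qed.

Lemma ae_all k (Q : 'I_k -> Omega -> Prop) :
  (forall i, {ae Pr, forall w, Q i w}) -> {ae Pr, forall w, forall i, Q i w}.
Proof. by move=> Qi; apply: filter_forall. Qed.

Let Rintegral_norm1_mono k (t T : R) (F : R -> 'cV[R]_k) : t \in `[0, T] ->
  (forall i, mu.-integrable `[0, T] (EFin \o (fun s => F s i 0))) ->
  \int[mu]_(s in `[0, t]) norm1 (F s) <= \int[mu]_(s in `[0, T]) norm1 (F s).
Proof.
move=> tT Fi; have Ni := integrable_norm1 (mitv T) Fi.
have := primitive_tail Ni tT.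
have := @Rintegral_ge0 _ _ _ mu `[t, T]%classic (fun s => norm1 (F s))
  (fun s _ => norm1_ge0 (F s)).
by lra.
Qed.

(* No moment of the state is assumed finite: its integrability is deduced from
   Gronwall's bound along each path. *)
Lemma state_path_bound T : 0 <= T -> exists a : R -> Omega -> R,
  [/\ process_L1 Pr T a, forall t w, 0 <= a t w &
   exists L, {ae Pr, forall w,
     (forall i, mu.-integrable `[0, T] (EFin \o (fun t => x t w i 0))) /\
     \int[mu]_(t in `[0, T]) norm1 (x t w)
       <= expR L * \int[mu]_(t in `[0, T]) a t w}].
Proof.
move=> T0; have [La La0 LaP] := norm1_mulmx A.
have [Lb Lb0 LbP] := norm1_mulmx B; have [Lc Lc0 LcP] := norm1_mulmx C.
pose U w := \int[mu]_(s in `[0, T]) norm1 (u s w).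
have U0 w : 0 <= U w by apply: Rintegral_ge0 => s _; exact: norm1_ge0.
(* The majorant for Gronwall: the control enters through its integral over all of [[0, T]], a random
   variable constant in time. *)
exists (fun t w => norm1 (x0 w) + Lb * U w + Lc * norm1 (W t w)); split.
- apply: process_L1D; last first.
    by apply: process_L1Z; apply: process_L1_norm1 => l; exact: brownian_L1.
  apply: process_L1D.
    apply: process_L1_cst; apply: integrable_sumR => // i.
    exact: integrable_norm (initial_integrable i).
  apply: (process_L1Z Lb (y := fun _ => U)).
  apply: process_L1_cst; apply: process_path_integral_integrable.
  by apply: process_L1_norm1 => i; exact: control_L1.
- by move=> t w; rewrite !addr_ge0 ?mulr_ge0 ?norm1_ge0.
exists (La * T).
have ui_ae := ae_all (fun i => process_L1_path (control_L1 T i)).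
have Wi_ae := ae_all (fun l => process_L1_path (brownian_L1 T l)).
have xc_ae := sde_cont hx; have xe_ae := sde_eq hx.
near=> w.
have xc : {within times, continuous (x ^~ w)} by near: w.
have xe (t : R) : 0 <= t -> x t w = x0 w
    + mxint `[0, t] (fun s => A *m x s w + B *m u s w) + C *m W t w.
  by move: t; near: w.
have ui i : mu.-integrable `[0, T] (EFin \o (fun t => u t w i 0)).
  by move: i; near: w.
have Wi i : mu.-integrable `[0, T] (EFin \o (fun t => W t w i 0)).
  by move: i; near: w.
(* Gronwall bounds an integral already known to be finite; finiteness comes from continuity of the
   path. *)
have xi i : mu.-integrable `[0, T] (EFin \o (fun t => x t w i 0)).
  apply: continuous_compact_integrable; first exact: segment_compact.
  have cT : {within `[0, T], continuous (x ^~ w)}.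
    exact: continuous_subspaceW (@itv_times T) xc.
  move=> t; have ci : continuous (fun v : 'cV[R]_n => v i 0).
    exact: coord_continuous.
  exact: cvg_comp (cT t) (ci (x t w)).
split=> //; apply: gronwall_L1 => //.
- exact: integrable_norm1 (mitv T) xi.
- apply: integrableDR => //; first exact: integrable_cst_itv.
  have := integrableZl (mitv T) Lc (integrable_norm1 (mitv T) Wi).
  exact.
- by move=> t _; rewrite !addr_ge0 ?mulr_ge0 ?norm1_ge0.
move=> t tT; have [t0 tleT] : 0 <= t /\ t <= T.
  by move: tT; rewrite in_itv /= => /andP[].
have xit i := integrable_head tT (xi i).
have uit i := integrable_head tT (ui i).
have Axi := integrable_mulmx_entry A (mitv t) xit.
have Bui := integrable_mulmx_entry B (mitv t) uit.
have Fi i : mu.-integrable `[0, t]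
    (EFin \o (fun s => (A *m x s w + B *m u s w) i 0)).
  have := integrableDR (mitv t) (Axi i) (Bui i).
  by apply: eq_integrable => // s _; rewrite /= !mxE.
rewrite (xe t t0); apply: le_trans (norm1D _ _) _.
have h1 := LcP (W t w).
have h2 := norm1D (x0 w) (mxint `[0, t] (fun s => A *m x s w + B *m u s w)).
have h3 := norm1_mxint (mitv t) Fi.
have xn := integrable_norm1 (mitv t) xit.
have un := integrable_norm1 (mitv t) uit.
have h4 : \int[mu]_(s in `[0, t]) norm1 (A *m x s w + B *m u s w) <=
    \int[mu]_(s in `[0, t]) (La * norm1 (x s w) + Lb * norm1 (u s w)).
  apply: le_Rintegral => //.
  - exact: integrable_norm1 (mitv t) Fi.
  - apply: integrableDR => //; first exact: (integrableZl (mitv t) La xn).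
    exact: (integrableZl (mitv t) Lb un).
  - by move=> s _; apply: le_trans (norm1D _ _) _; exact: lerD.
rewrite RintegralD// in h4; last 2 first.
- exact: (integrableZl (mitv t) La xn).
- exact: (integrableZl (mitv t) Lb un).
rewrite !RintegralZl// in h4.
have h5 : Lb * \int[mu]_(s in `[0, t]) norm1 (u s w) <= Lb * U w.
  by rewrite ler_wpM2l// Rintegral_norm1_mono.
apply: le_trans (lerD (le_trans h2 (lerD (lexx _)
  (le_trans h3 (le_trans h4 (lerD (lexx _) h5))))) h1) _.
by rewrite [leRHS]addrAC lerD2r -[leRHS]addrA lerD2l [leRHS]addrC.
Unshelve. all: by end_near. Qed.

Lemma state_L1 T i : 0 <= T -> process_L1 Pr T (fun t w => x t w i 0).
Proof.
move=> T0; have [a [aL a0 [L key]]] := state_path_bound T0.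
apply: process_L1_of_path (px i) _.
have ai := integrableZl measurableT (expR L) (process_path_integral_integrable aL).
apply: le_lt_trans (integrable_lty measurableT ai).
apply: ae_ge0_le_integral => //.
- by move=> w _; apply: integral_ge0.
- by apply: measurable_path_integral => //; exact: process_norm.
- move=> w _; rewrite mule_ge0 ?lee_fin ?expR_ge0//.
  by apply: Rintegral_ge0 => t _; exact: a0.
- exact: measurable_int ai.
apply: filterS key => w [xi xle] _.
have xn := integrable_norm (xi i).
rewrite -[leLHS]fineK; last exact: (integrable_fin_num (mitv T) xn).
rewrite -EFinM lee_fin; apply: le_trans xle.
apply: (le_Rintegral (mitv T) xn (integrable_norm1 (mitv T) xi)) => t _.
exact: norm1_entry.
Qed.

Lemma expectE k (Y : Omega -> 'cV[R]_k) i :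
  expect Pr Y i 0 = \int[Pr]_w Y w i 0.
Proof. by rewrite mxE unlock. Qed.

Variables (X : R -> 'cV[R]_n) (V : R -> 'cV[R]_m).
Hypotheses (hX : forall t, X t = expect Pr (x t))
           (hV : forall t, V t = expect Pr (u t)).

Lemma mean_control_integrable T i :
  mu.-integrable `[0, T] (EFin \o (fun t => V t i 0)).
Proof.
have := process_mean_integrable (control_L1 T i).
by apply: eq_integrable => // t _; rewrite /= hV expectE.
Qed.

Lemma mean_state_integrable T i : 0 <= T ->
  mu.-integrable `[0, T] (EFin \o (fun t => X t i 0)).
Proof.
move=> T0; have := process_mean_integrable (state_L1 i T0).
by apply: eq_integrable => // t _; rewrite /= hX expectE.
Qed.

Let drift i t w : R := (A *m x t w + B *m u t w) i 0.

Lemma drift_L1 T i : 0 <= T -> process_L1 Pr T (drift i).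
Proof.
move=> T0.
have -> : drift i = (fun t w => \sum_j A i j * x t w j 0 + \sum_j B i j * u t w j 0).
  by apply/funext => t; apply/funext => w; rewrite /drift !mxE.
apply: process_L1D; apply: process_L1_sum => j; apply: process_L1Z.
  exact: state_L1.
exact: control_L1.
Qed.

Lemma mean_drift_integrable T i : 0 <= T ->
  mu.-integrable `[0, T] (EFin \o (fun t => (A *m X t + B *m V t) i 0)).
Proof.
move=> T0; have Xi := fun j => mean_state_integrable j T0.
have := integrableDR (mitv T) (integrable_mulmx_entry A (mitv T) Xi i)
  (integrable_mulmx_entry B (mitv T) (mean_control_integrable T) i).
by apply: eq_integrable => // t _; rewrite /= !mxE.
Qed.

(** Expectation is exchanged with [A] and [B] at times when state and control are integrable. This
    is almost every time, which is enough under the time integral. *)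
Lemma mean_drift T i : 0 <= T ->
  \int[mu]_(t in `[0, T]) (\int[Pr]_w drift i t w) =
  \int[mu]_(t in `[0, T]) ((A *m X t + B *m V t) i 0).
Proof.
move=> T0; congr fine; apply: ae_eq_integral => //.
- exact: measurable_int (process_mean_integrable (drift_L1 i T0)).
- exact: measurable_int (mean_drift_integrable i T0).
have xi : {ae mu, forall t, forall j, t \in `[0, T] ->
    Pr.-integrable setT (EFin \o (fun w => x t w j 0))}.
  by apply: filter_forall => j; exact: process_L1_state (state_L1 j T0).
have ui : {ae mu, forall t, forall j, t \in `[0, T] ->
    Pr.-integrable setT (EFin \o (fun w => u t w j 0))}.
  by apply: filter_forall => j; exact: process_L1_state (control_L1 T j).
near=> t; move=> /= tT; congr EFin.
have xt j : Pr.-integrable setT (EFin \o (fun w => x t w j 0)).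
  by move: j tT; near: t.
have ut j : Pr.-integrable setT (EFin \o (fun w => u t w j 0)).
  by move: j tT; near: t.
have -> : \int[Pr]_w drift i t w =
    \int[Pr]_w (\sum_j A i j * x t w j 0 + \sum_j B i j * u t w j 0).
  by apply: eq_Rintegral => w _; rewrite /drift !mxE.
have Ax j := integrableZl measurableT (A i j) (xt j).
have Bu j := integrableZl measurableT (B i j) (ut j).
rewrite RintegralD//; last 2 first.
- exact: (integrable_sumR _ measurableT Ax).
- exact: (integrable_sumR _ measurableT Bu).
rewrite (Rintegral_sum _ measurableT Ax) (Rintegral_sum _ measurableT Bu) !mxE.
by congr (_ + _); apply: eq_bigr => j _; rewrite RintegralZl// ?hX ?hV expectE.
Unshelve. all: by end_near. Qed.

(** Expectation of the state equation at a fixed time: Fubini exchanges it with the drift integral,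
    and the noise term vanishes because [W t] is centred. *)
Lemma mean_state t i : 0 <= t -> X t i 0 = \int[Pr]_w x0 w i 0
  + \int[mu]_(s in `[0, t]) ((A *m X s + B *m V s) i 0).
Proof.
move=> t0; rewrite hX expectE -mean_drift// -process_fubini; last exact: drift_L1.
have Wi l : Pr.-integrable setT (EFin \o (fun w => W t w l 0)).
  apply/integrableP; split.
    by apply/measurable_EFinP; exact: process_section_omega (pW l) t0.
  by apply: le_lt_trans (brownian_moment l t0).1 _; rewrite ltry.
have CWi l := integrableZl measurableT (C i l) (Wi l).
have CW := integrable_sumR (index_enum 'I_p) measurableT CWi.
have di := process_path_integral_integrable (drift_L1 i t0).
have xd := integrableDR measurableT (initial_integrable i) di.
transitivity (\int[Pr]_w (x0 w i 0 + \int[mu]_(s in `[0, t]) drift i s w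
    + \sum_l C i l * W t w l 0)).
  congr fine; apply: ae_eq_integral => //.
  - by apply/measurable_EFinP; exact: process_section_omega (px i) t0.
  - exact: measurable_int (integrableDR measurableT xd CW).
  have := sde_eq hx; apply: filterS => w /(_ t t0) -> _.
  by rewrite /= !mxE.
rewrite RintegralD// RintegralD//; last exact: initial_integrable.
rewrite (Rintegral_sum _ measurableT CWi) [X in _ + X]big1 ?addr0// => l _.
by rewrite RintegralZl// /Rintegral (brownian_moment l t0).2 mulr0.
Qed.

Lemma mean_primitive T i : 0 <= T -> primitive_on 0 T
  (fun t => X t i 0) (fun t => (A *m X t + B *m V t) i 0).
Proof.
move=> T0; split=> [|t]; first exact: mean_drift_integrable.
rewrite in_itv /= => /andP[t0 _]; rewrite (mean_state i t0).
by rewrite (mean_state i (lexx 0)) set_itv1 Rintegral_set1 addr0.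
Qed.

End MeanDynamics.

Lemma sampling_times_ge0 (R : realType) (s : nat -> R) : 0 <= s 0%N ->
  (forall j, s j < s j.+1) -> forall j, 0 <= s j.
Proof. by move=> s0 hs; elim=> // j IH; exact: le_trans IH (ltW (hs j)). Qed.

(** Row [j] is [quadratic_increment] on [[s j, s j.+1]], once the base point of the primitives is
    moved from 0 to [s j]. *)
Lemma data_identity (R : realType) (n m : nat) (A : 'M[R]_n) (B : 'M[R]_(n, m))
    (rho : R) (s : nat -> R) (X : R -> 'cV[R]_n) (V : R -> 'cV[R]_m) (d : nat)
    (S : 'M[R]_n) :
  0 <= s 0%N -> (forall j, s j < s j.+1) ->
  (forall T i, 0 <= T -> primitive_on 0 T (fun t => X t i 0)
     (fun t => (A *m X t + B *m V t) i 0)) ->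
  (forall T i, lebesgue_measure.-integrable `[0, T] (EFin \o (fun t => V t i 0))) ->
  S^T = S ->
  data_I rho s X d *m vecs S =
    data_IX rho s X d *m vecs (S *m A + A^T *m S - rho *: S)
    + 2 *: (data_IXV rho s X V d *m vec (B^T *m S)).
Proof.
move=> s0 hs Xp Vi Ssym; have sge0 := sampling_times_ge0 s0 hs.
apply/matrixP => j k; rewrite ord1 {k}.
have row0 a (M : 'M[R]_(d, a)) (w : 'cV[R]_a) :
    (M *m w) j 0 = (row j M *m w) 0 0.
  by rewrite -row_mul [RHS]mxE.
have sj : s j \in `[0, s j.+1] by rewrite in_itv /= sge0 ltW.
have Xj i := primitive_onS sj (Xp _ i (sge0 j.+1)).
have Vj i : lebesgue_measure.-integrable `[s j, s j.+1] (EFin \o (fun t => V t i 0)).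
  apply: integrableS (Vi (s j.+1) i) => //.
  by apply: subset_itv; rewrite bnd_simp.
rewrite [RHS]mxE [X in _ = _ + X]mxE !row0 !rowK.
rewrite -(quadratic_increment rho Xj Vj (ltW (hs j)) Ssym).
rewrite mulmxBl mxE [X in _ + X]mxE -!scalemxAl !mxE.
by congr (_ * _ - _ * _); rewrite -quadv_vecs// mxE.
Qed.

Theorem theorem2 (R : realType) (n m p : nat)
    (A : 'M[R]_n) (B : 'M[R]_(n, m)) (C : 'M[R]_(n, p))
    (Qw : 'M[R]_n) (Rw : 'M[R]_m) (rho : R)
    (hQ : posdef Qw) (hR : posdef Rw) (hrho : 0 < rho)
    (* target gain *)
    (Pstar : 'M[R]_n) (Kstar : 'M[R]_(m, n))
    (hPstar : posdef Pstar)
    (hARE : rho *: Pstar = Pstar *m A + A^T *m Pstar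
              - Pstar *m B *m invmx Rw *m B^T *m Pstar + Qw)
    (hKstar : Kstar = invmx Rw *m B^T *m Pstar)
    (* agent *)
    (disp : measure_display) (Omega : measurableType disp)
    (Pr : probability Omega R)
    (W : R -> Omega -> 'cV[R]_p) (x0 : Omega -> 'cV[R]_n)
    (u : R -> Omega -> 'cV[R]_m) (x : R -> Omega -> 'cV[R]_n)
    (hW : brownian_motion Pr W) (hx0 : initial_state Pr W x0)
    (hu : admissible Pr rho W u) (hx : solves_sde Pr A B C W x0 u x)
    (X : R -> 'cV[R]_n) (V : R -> 'cV[R]_m)
    (hX : forall t, X t = expect Pr (x t))
    (hV : forall t, V t = expect Pr (u t))
    (* sampling times *)
    (s : nat -> R) (hs0 : 0 <= s 0%N) (hs : forall j, s j < s j.+1)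
    (* assumptions *)
    (hA : forall z, spectrum A z -> complex.Re z != rho)
    (hAB : stabilizable A B)
    (hAH : hurwitz (A - (rho / 2)%:M))
    (dhat : nat) (hdhat : (0 < dhat)%N)
    (hrank : forall d : nat, (dhat <= d)%N ->
       \rank (row_mx (data_IX rho s X d) (data_IXV rho s X V d))
         = (m * n + (n * n.+1)./2)%N)
    (* algorithm *)
    (d : nat) (hd : (dhat <= d)%N)
    (P0 : 'M[R]_n) (gamma : nat -> R) (D : nat -> set 'M[R]_n)
    (hP0 : posdef P0) (hgamma : step_sizes gamma) (hD : truncations D)
    (P M : nat -> 'M[R]_n) (N K : nat -> 'M[R]_(m, n)) (q : nat -> nat)
    (hrun : value_iteration (data_IX rho s X d) (data_I rho s X d)
       (data_IXV rho s X V d) Qw Rw P0 gamma D P M N K q) :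
  K @ \oo --> Kstar.
Proof.
rewrite hKstar.
apply: (data_driven_cvg hQ hR (hrank d hd) _ hrun hPstar hARE hP0 hgamma hD).
move=> S Ssym; apply: data_identity => // [T i T0|T i].
  exact: (mean_primitive hrho hW hx0 hu hx hX hV i T0).
exact: (mean_control_integrable hrho hu hV T i).
Qed.
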